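(* Let $g$ be a non-negative integer and let $m,n$ be positive integers such that $(g,n+m)\neq(0,2)$. Let $\mathfrak{c}$ be a chamber of the hyperplane arrangement $\mathcal{W}(m,n)$. Then there exist polynomials $P_g^{\mathfrak{c},\le}$ and $P_g^{\mathfrak{c},<}$ of degree $4g-3+m+n$ in $m+n$ variables such that $$h^{\le}_{g;\mu,\nu}=P_g^{\mathfrak{c},\le}(\mu,\nu),\qquad h^{<}_{g;\mu,\nu}=P_g^{\mathfrak{c},<}(\mu,\nu)$$ for all $(\mu,\nu)\in\mathfrak{c}$, where $h^{\le}_{g;\mu,\nu}$ and $h^{<}_{g;\mu,\nu}$ are the double monotone and double strictly monotone Hurwitz numbers.
   Context: **Hurwitz numbers.** An ordered partition is a finite tuple of positive integers. Let $\mu=(\mu_1,\dots,\mu_m)$, $\nu=(\nu_1,\dots,\nu_n)$ be ordered partitions of the same integer $d$, and $b=2g-2+m+n$. A factorisation of type $(g,\mu,\nu)$ is a tuple $(\sigma_1,\tau_1,\dots,\tau_b,\sigma_2)$ of elements of $S_d$ with $\sigma_2\tau_b\cdots\tau_1\sigma_1=\mathrm{id}$, where $\sigma_1$ has cycle type $\mu$, $\sigma_2$ has cycle type $\nu$, every $\tau_i$ is a transposition, and the disjoint cycles of $\sigma_1$ (resp. $\sigma_2$) are labelled $1,\dots,m$ (resp. $1,\dots,n$) so that cycle $i$ has length $\mu_i$ (resp. $\nu_i$); the labellings are part of the data and no transitivity is required. Write $\tau_i=(r_i\ s_i)$ with $r_i>s_i$. Then $h^{\le}_{g;\mu,\nu}$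 is $\frac1{d!}$ times the number of factorisations with $s_i\le s_{i+1}$ for $i=1,\dots,b-1$, and $h^{<}_{g;\mu,\nu}$ is $\frac1{d!}$ times the number of factorisations with $s_i<s_{i+1}$ for $i=1,\dots,b-1$. **Chambers.** $\mathcal{H}(m,n)$ is the set of pairs $(M,N)$ of tuples of positive integers of lengths $m,n$ with $\sum_iM_i=\sum_jN_j$. The walls of $\mathcal{W}(m,n)$ are the loci $\sum_{i\in I}M_i=\sum_{j\in J}N_j$ for $I\subset\{1,\dots,m\}$, $J\subset\{1,\dots,n\}$, with $(I,J)$ not equal to $(\emptyset,\emptyset)$ or $([m],[n])$. A chamber is a non-empty set consisting of all points of $\mathcal{H}(m,n)$ that lie on no wall and on a prescribed side of each wall. *)

(* Defs.v *)
From HB Require Import structures.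
From mathcomp Require Import all_boot all_order all_fingroup all_algebra.
From mathcomp Require Import mpoly.

Set Implicit Arguments.
Unset Strict Implicit.
Unset Printing Implicit Defensive.

(* L lists the disjoint cycles of s, each represented by its support and fixed
   points included, so that the i-th one has length mu_i. Such an L exists
   exactly when s has cycle type mu. *)
Definition cycle_labelling (d m : nat) (mu : m.-tuple nat) (s : 'S_d)
    (L : m.-tuple {set 'I_d}) : bool :=
  perm_eq L (enum (porbits s)) && ([seq #|C| | C : {set 'I_d} <- L] == mu).

(* Every tau_i is a transposition (r_i s_i) with s_i < r_i, and consecutive
   s_i are related by e. *)
Definition monotone_transpositions (e : rel nat) (d b : nat)
    (tau : b.-tuple 'S_d) : bool :=
  [exists r : b.-tuple 'I_d, exists s : b.-tuple 'I_d,
    [&& [forall i, tnth s i < tnth r i],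
        [forall i, tnth tau i == tperm (tnth r i) (tnth s i)]
      & sorted e [seq nat_of_ord x | x <- s]]].

(* Permutations multiply left to right in MathComp: (s * t) x = t (s x). The
   equation sigma_2 tau_b ... tau_1 sigma_1 = id, a composition of functions,
   is therefore written sigma_1 * tau_1 * ... * tau_b * sigma_2 = 1. *)
Definition factorisations (e : rel nat) (g m n : nat)
    (mu : m.-tuple nat) (nu : n.-tuple nat) :=
  let d := sumn mu in
  let b := 2 * g + m + n - 2 in
  [set f : 'S_d * b.-tuple 'S_d * 'S_d *
           m.-tuple {set 'I_d} * n.-tuple {set 'I_d} |
    let: (sigma1, tau, sigma2, L1, L2) := f in
    [&& (sigma1 * (\prod_(i < b) tnth tau i) * sigma2 == 1)%g,
        cycle_labelling mu sigma1 L1,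
        cycle_labelling nu sigma2 L2
      & monotone_transpositions e tau]].

Definition hurwitz (e : rel nat) (g m n : nat)
    (mu : m.-tuple nat) (nu : n.-tuple nat) : rat :=
  (#|factorisations e g mu nu|%:R / ((sumn mu)`!)%:R)%R.

Definition hurwitz_le (g m n : nat) (mu : m.-tuple nat) (nu : n.-tuple nat) :=
  hurwitz leq g mu nu.

Definition hurwitz_lt (g m n : nat) (mu : m.-tuple nat) (nu : n.-tuple nat) :=
  hurwitz ltn g mu nu.

Definition in_H (m n : nat) (M : m.-tuple nat) (N : n.-tuple nat) : bool :=
  [&& all (leq 1) M, all (leq 1) N & sumn M == sumn N].

Definition wall_index (m n : nat) (IJ : {set 'I_m} * {set 'I_n}) : bool :=
  (IJ != (set0, set0)) && (IJ != (setT, setT)).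

(* The sign of the wall (I, J) is true on the side sum_I M < sum_J N. *)
Definition on_side (m n : nat) (sign : bool) (IJ : {set 'I_m} * {set 'I_n})
    (M : m.-tuple nat) (N : n.-tuple nat) : bool :=
  let sM := \sum_(i in IJ.1) tnth M i in
  let sN := \sum_(j in IJ.2) tnth N j in
  if sign then sM < sN else sN < sM.

Definition is_chamber (m n : nat) (c : {pred m.-tuple nat * n.-tuple nat}) :
    Prop :=
  (exists x, x \in c) /\
  exists side : {set 'I_m} * {set 'I_n} -> bool,
  forall M N, (M, N) \in c =
    in_H M N && [forall IJ, wall_index IJ ==> on_side (side IJ) IJ M N].

Definition eval_at (m n : nat) (P : {mpoly rat[m + n]})
    (M : m.-tuple nat) (N : n.-tuple nat) : rat :=
  P.@[fun i : 'I_(m + n) => ((tnth (cat_tuple M N) i)%:R)%R].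

(* msize is one more than the total degree, and 0 for the zero polynomial. *)
Definition has_degree (k D : nat) (P : {mpoly rat[k]}) : Prop :=
  msize P = D.+1.

(* Main.v *)
Require Import Defs.
From mathcomp Require Import all_boot all_order all_fingroup all_algebra.
From mathcomp Require Import mpoly ring lra zify.

(** Fix the relative order of the entries [r_i], [s_i] of the transpositions and
   let [k <= 2b] be the number of distinct entries. As everything but this
   order is invariant under conjugation, summing over the increasing embeddings
   of [{1..k}] amounts to [1/k!] times summing over all injections of [{1..k}]
   as marked points. Off the walls every cycle of [sigma_1] is marked: an
   unmarked one would also be a cycle of [sigma_2] up to inversion. Hence
   [sigma_1] is determined, up to relabelling, by its first return permutation
   to the marked points and the positive return times. Labellings become
   colourings of the marked points, and the Hurwitz number is a combination,
   with coefficients depending only on [g, m, n], of the numbers of positive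
   integral edge weightings, with vertex sums [mu] and [nu], of bipartite
   graphs on [m + n] vertices with at most [2b] edges.

   Such a number is polynomial of degree at most [k - (m + n) + 1] on a chamber:
   a weight summed along a cycle of the graph telescopes to boundary terms in
   which some edge of the cycle vanishes, at the cost of one more degree, and on
   a spanning tree the weight of an edge is the net demand of one side of it,
   whose sign is constant on the chamber. *)

Set Implicit Arguments.
Unset Strict Implicit.
Unset Printing Implicit Defensive.
Import Order.TTheory GRing.Theory Num.Theory.

Local Open Scope ring_scope.

(** * Antidifferences of multivariate polynomials *)

Lemma leq_msizeD (k : nat) (D : nat) (p q : {mpoly rat[k]}) :
  (msize p <= D)%N -> (msize q <= D)%N -> (msize (p + q) <= D)%N.
Proof.
by move=> hp hq; apply: leq_trans (msizeD_le p q) _; rewrite geq_max hp.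
Qed.

Lemma leq_msize_sum (k : nat) (D : nat) (I : Type) (r : seq I) (P : pred I)
    (F : I -> {mpoly rat[k]}) :
  (forall i, P i -> (msize (F i) <= D)%N) ->
  (msize (\sum_(i <- r | P i) F i) <= D)%N.
Proof.
move=> hF; elim/big_rec: _ => [|i p Pi hp]; first by rewrite msize0.
by apply: leq_msizeD => //; exact: hF.
Qed.

Lemma leq_msizeM (k : nat) (D1 D2 : nat) (p q : {mpoly rat[k]}) :
  (msize p <= D1.+1)%N -> (msize q <= D2.+1)%N ->
  (msize (p * q) <= (D1 + D2).+1)%N.
Proof.
move=> hp hq; have [->|p0] := eqVneq p 0; first by rewrite mul0r msize0.
have [->|q0] := eqVneq q 0; first by rewrite mulr0 msize0.
rewrite msizeM // -subn1 leq_subLR add1n -addnS -addSn.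
exact: leq_add.
Qed.

(** A monomial of degree [N] arises from 1 by [N] multiplications by a variable, each raising the
    bound by one. The index bounds [msize], hence the start at 1. *)
Lemma mpoly_ind_msize (k : nat) (K : nat -> {mpoly rat[k]} -> Prop) :
  (forall D, K D 0) ->
  (forall D p q, K D p -> K D q -> K D (p + q)) ->
  (forall D c p, K D p -> K D (c *: p)) ->
  (forall D D' p, (D <= D')%N -> K D p -> K D' p) ->
  K 1%N 1 ->
  (forall D i p, K D.+1 p -> K D.+2 ('X_i * p)) ->
  forall D p, (msize p <= D)%N -> K D p.
Proof.
move=> K0 KD KZ Kle K1 KX.
have KM N : forall m : 'X_{1..k}, mdeg m = N -> K N.+1 'X_[m].
  elim: N => [|N IH] m hm.
    by move/eqP: hm; rewrite mdeg_eq0 => /eqP ->; rewrite mpolyX0.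
  have [i hi] : exists i, (0 < m i)%N.
    apply/existsP; apply: contraTT isT => /existsPn h; exfalso.
    suff: mdeg m = 0%N by rewrite hm.
    by rewrite mdegE big1 // => i _; apply/eqP; rewrite -leqn0 leqNgt h.
  have em : (U_(i) + (m - U_(i)))%MM = m.
    by rewrite addmC submK //; apply/mnm_lepP => j; rewrite mnm1E; case: eqP => // <-.
  rewrite -em mpolyXD; apply: KX; apply: IH.
  by move: hm; rewrite -{1}em mdegD mdeg1 => -[].
move=> D p hp; rewrite (mpolyE p) big_seq.
elim/big_rec: _ => [|m q hm hq] //; apply: KD => //; apply: KZ.
apply: Kle (KM _ m erefl).
exact: leq_trans (msize_mdeg_lt hm) hp.
Qed.

Lemma msize_comp_linear (k l D : nat) (lq : k.-tuple {mpoly rat[l]}) :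
  (forall i, (msize (tnth lq i) <= 2)%N) ->
  forall p : {mpoly rat[k]}, (msize p <= D)%N -> (msize (p \mPo lq) <= D)%N.
Proof.
move=> hl; apply: (@mpoly_ind_msize k
  (fun D p => (msize (p \mPo lq) <= D)%N)) => //.
- by move=> D'; rewrite comp_mpoly0 msize0.
- by move=> D' p q hp hq; rewrite comp_mpolyD; exact: leq_msizeD.
- by move=> D' c p hp; rewrite comp_mpolyZ; exact: leq_trans (msizeZ_le _ _) hp.
- by move=> D1 D2 p hD hp; exact: leq_trans hp hD.
- by rewrite comp_mpoly1 msize1.
move=> D' i p hp; rewrite rmorphM /= comp_mpolyXU -tnth_nth.
exact: (@leq_msizeM l 1 D').
Qed.

Definition translate (k : nat) (z : 'I_k -> rat) (p : {mpoly rat[k]}) :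
  {mpoly rat[k]} := p \mPo [tuple 'X_i + (z i)%:MP | i < k].

Lemma meval_translate (k : nat) (z v : 'I_k -> rat) (p : {mpoly rat[k]}) :
  (translate z p).@[v] = p.@[fun i => v i + z i].
Proof.
rewrite comp_mpoly_meval; apply: meval_eq => i.
by rewrite tnth_mktuple mevalD mevalXU mevalC.
Qed.

Lemma translateM (k : nat) (z : 'I_k -> rat) (p q : {mpoly rat[k]}) :
  translate z (p * q) = translate z p * translate z q.
Proof. exact: rmorphM. Qed.

Lemma translateX (k : nat) (z : 'I_k -> rat) (i : 'I_k) :
  translate z 'X_i = 'X_i + (z i)%:MP.
Proof. by rewrite /translate comp_mpolyXU -tnth_nth tnth_mktuple. Qed.

Lemma msizeX_C (k : nat) (c : rat) (i : 'I_k) :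
  (msize ('X_i + c%:MP : {mpoly rat[k]}) <= 2)%N.
Proof.
apply: leq_msizeD; first by rewrite msizeX mdeg1.
by rewrite msizeC; case: eqP.
Qed.

(** By the product rule, the difference of ['X_i * p] is ['X_i] times the difference of [p] plus a
    multiple of the translate of [p]; so both sizes are bounded together. *)
Lemma msize_translateB (k D : nat) (z : 'I_k -> rat) (p : {mpoly rat[k]}) :
  (msize p <= D.+1)%N -> (msize (translate z p - p) <= D)%N.
Proof.
move=> hp.
suff [] : (msize (translate z p) <= D.+1)%N /\
          (msize (translate z p - p) <= D.+1.-1)%N by [].
apply: (@mpoly_ind_msize k (fun D p => (msize (translate z p) <= D)%N /\
  (msize (translate z p - p) <= D.-1)%N)) hp => {p D}.
- by move=> D; rewrite /translate comp_mpoly0 subr0 msize0.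
- move=> D p q [hp hp'] [hq hq']; rewrite /translate comp_mpolyD.
  split; first exact: leq_msizeD.
  by rewrite opprD addrACA; exact: leq_msizeD.
- move=> D c p [hp hp']; rewrite /translate comp_mpolyZ -scalerBr.
  by split; apply: leq_trans (msizeZ_le _ _) _.
- move=> D D' p hD [hp hp']; split; first exact: leq_trans hp hD.
  by apply: leq_trans hp' _; lia.
- by rewrite /translate comp_mpoly1 subrr msize0 msize1.
move=> D i p [hp hp'] /=; rewrite translateM translateX; split.
  exact: (@leq_msizeM k 1 D) (msizeX_C _ _) hp.
have -> : ('X_i + (z i)%:MP) * translate z p - 'X_i * p =
  'X_i * (translate z p - p) + z i *: translate z p.
  by rewrite -mul_mpolyC; ring.
apply: leq_msizeD; last exact: leq_trans (msizeZ_le _ _) hp.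
have [->|d0] := eqVneq (translate z p - p) 0; first by rewrite mulr0 msize0.
move: hp'; case: D {hp} => [|D] hp'.
  by move: d0; rewrite -msize_poly_eq0 -leqn0 hp'.
by apply: (@leq_msizeM k 1 D) hp'; rewrite msizeX mdeg1.
Qed.

(* Newton's summation by parts: with [y] increasing by 1 under the shift and
   [f_j = binom (y + j) (j + 1)], the sum of the [(-1)^j f_j Delta^j q] is an
   antidifference of [q]. *)
Lemma antidifference (k D : nat) (z : 'I_k -> rat) (q : {mpoly rat[k]})
    (e0 : 'I_k) :
  z e0 * z e0 = 1 -> (msize q <= D)%N ->
  exists2 A : {mpoly rat[k]}, (msize A <= D.+1)%N & translate z A - A = q.
Proof.
move=> hz hq; pose y : {mpoly rat[k]} := z e0 *: 'X_e0.
have ty : translate z y = y + 1.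
  rewrite /translate comp_mpolyZ -/(translate z 'X_e0) translateX scalerDr.
  by congr (_ + _); rewrite -mul_mpolyC -mpolyCM hz.
have sy : (msize y <= 2)%N.
  by apply: leq_trans (msizeZ_le _ _) _; rewrite msizeX mdeg1.
pose f j : {mpoly rat[k]} :=
  (j.+1`!%:R)^-1 *: \prod_(i < j.+1) (y + i%:R).
pose h j : {mpoly rat[k]} :=
  (j`!%:R)^-1 *: \prod_(i < j) (y + i.+1%:R).
have sf j : (msize (f j) <= j.+2)%N.
  apply: leq_trans (msizeZ_le _ _) _; elim: j.+1 => [|i IH].
    by rewrite big_ord0 msize1.
  rewrite big_ord_recr /= -[i.+1]addn1; apply: leq_msizeM => //.
  apply: leq_msizeD => //; rewrite -mpolyC_nat msizeC; by case: eqP.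
have tr_prod (I : finType) (F : I -> {mpoly rat[k]}) :
    translate z (\prod_i F i) = \prod_i translate z (F i).
  exact: rmorph_prod.
have tyi (i : nat) : translate z (y + i%:R) = y + i.+1%:R.
  rewrite -mpolyC_nat /translate comp_mpolyD comp_mpolyC -/(translate z y) ty.
  by rewrite mpolyC_nat -addrA -[1 + _]/(1%:R + _) -natrD.
(* [h j] is the binomial of [y + j] over [j]. The shift turns [f j] into [h j.+1], and [df] is
   Pascal's rule. *)
have tf j : translate z (f j) = h j.+1.
  rewrite /translate comp_mpolyZ -/(translate z _) tr_prod /h.
  by congr (_ *: _); apply: eq_bigr => i _; exact: tyi.
have df j : h j.+1 - f j = h j.
  rewrite /h /f big_ord_recr /= [X in _ - _ *: X]big_ord_recl /= -scalerBr.
  under [X in _ - _ * X]eq_bigr => i _ do rewrite /bump /= add1n.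
  set P := \prod_(i < j) _; rewrite addr0.
  have -> : P * (y + j.+1%:R) - y * P = j.+1%:R *: P.
    by rewrite -mul_mpolyC mpolyC_nat; ring.
  rewrite scalerA factS natrM invfM mulrAC mulVf ?mul1r //.
  by rewrite pnatr_eq0.
(* Generalised from [q] to [h j * q]: the difference of [f j * q] is [h j * q] plus [h j.+1] times
   the difference of [q], which has a smaller size bound. *)
suff H : forall D j q, (msize q <= D)%N ->
    exists2 A : {mpoly rat[k]},
      (msize A <= (D + j).+1)%N & translate z A - A = h j * q.
  have [A sA eA] := H D 0%N q hq; exists A; first by rewrite -[D]addn0.
  by rewrite eA /h big_ord0 fact0 invr1 scale1r mul1r.
elim => {q D hq} [|D IH] j q hq.
  exists 0; rewrite ?msize0 //.
  move: hq; rewrite leqn0 msize_poly_eq0 => /eqP ->.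
  by rewrite /translate comp_mpoly0 subrr mulr0.
have [B sB eB] := IH j.+1 _ (msize_translateB z hq).
exists (f j * q - B).
  apply: leq_msizeD.
    have -> : (D.+1 + j).+1 = (j.+1 + D).+1 by lia.
    exact: leq_msizeM.
  by rewrite msizeN; apply: leq_trans sB _; lia.
rewrite /translate comp_mpolyB -/(translate z (f j * q)) -/(translate z B).
rewrite translateM tf.
have -> : translate z B = B + h j.+1 * (translate z q - q).
  by rewrite -eB; ring.
by rewrite -(df j); ring.
Qed.

(** * Sums over integral flows *)

Lemma sum_bij (V : nmodType) (I J : finType) (P : pred I) (Q : pred J)
    (h : J -> I) (h' : I -> J) (F : I -> V) :
  (forall i, P i -> Q (h' i)) -> (forall j, Q j -> P (h j)) ->
  (forall i, P i -> h (h' i) = i) -> (forall j, Q j -> h' (h j) = j) ->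
  \sum_(i | P i) F i = \sum_(j | Q j) F (h j).
Proof.
move=> h'Q hP hK h'K; rewrite (reindex_onto h h') //; apply: eq_bigl => j.
apply/andP/idP => [[Pj /eqP <-]|Qj]; first exact: h'Q.
by rewrite hP // h'K.
Qed.

Section Flows.

Variables (p k : nat) (src tgt : 'I_k -> 'I_p).
Implicit Types (S : {set 'I_k}) (A : {set 'I_p}) (Z l : 'I_k -> int)
  (x : 'I_p -> int).

Definition boundary l (v : 'I_p) : int :=
  \sum_e l e * ((src e == v)%:R - (tgt e == v)%:R).

Lemma boundary_ext l l' : l =1 l' -> boundary l =1 boundary l'.
Proof. by move=> h v; apply: eq_bigr => e _; rewrite h. Qed.

Lemma boundaryD l l' v :
  boundary (fun e => l e + l' e) v = boundary l v + boundary l' v.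
Proof. by rewrite -big_split; apply: eq_bigr => e _; rewrite mulrDl. Qed.

Lemma boundaryN l v : boundary (fun e => - l e) v = - boundary l v.
Proof. by rewrite -sumrN; apply: eq_bigr => e _; rewrite mulNr. Qed.

Lemma boundary_sum (I : finType) (c : I -> int) (l : I -> 'I_k -> int) v :
  boundary (fun e => \sum_i c i * l i e) v = \sum_i c i * boundary (l i) v.
Proof.
rewrite /boundary; under eq_bigr => e _ do rewrite big_distrl /=.
rewrite exchange_big; apply: eq_bigr => i _ /=.
by rewrite mulr_sumr; apply: eq_bigr => e _; rewrite mulrA.
Qed.

Lemma boundary_delta e0 c v :
  boundary (fun e => (e == e0)%:R * c) v
  = c * ((src e0 == v)%:R - (tgt e0 == v)%:R).
Proof.
rewrite /boundary (bigD1 e0) //= eqxx mul1r big1 ?addr0 // => e /negbTE ->.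
by rewrite !mul0r.
Qed.

(** Only edges crossing the cut around [A] count. A component has no crossing edge, the side of a
    bridge exactly one. *)
Lemma sum_boundary l A :
  \sum_(v in A) boundary l v
  = \sum_e l e * ((src e \in A)%:R - (tgt e \in A)%:R).
Proof.
rewrite exchange_big; apply: eq_bigr => e _ /=; rewrite -mulr_sumr.
have mem (u : 'I_p) : \sum_(v in A) (u == v)%:R = (u \in A)%:R :> int.
  have [uA|uA] := boolP (u \in A).
    by rewrite (bigD1 u) //= eqxx big1 ?addr0 // => v /andP[_]; rewrite eq_sym => /negbTE ->.
  by rewrite big1 // => v vA; case: eqP => // uv; rewrite uv vA in uA.
by rewrite sumrB !mem.
Qed.

Definition adjacent S : rel 'I_p := [rel u v | [exists e in S,
  (src e == u) && (tgt e == v) || (src e == v) && (tgt e == u)]].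

Lemma adjacent_sym S : ssrbool.symmetric (adjacent S).
Proof. by move=> u v; apply: eq_existsb => e; rewrite orbC. Qed.

Definition component S u : {set 'I_p} := [set v | connect (adjacent S) u v].

Lemma mem_component S u e : e \in S ->
  (src e \in component S u) = (tgt e \in component S u).
Proof.
move=> eS; have a1 : adjacent S (src e) (tgt e).
  by apply/existsP; exists e; rewrite eS !eqxx.
rewrite !inE; apply/idP/idP => h; apply: connect_trans h (connect1 _) => //.
by rewrite adjacent_sym.
Qed.

Definition unit_coef Z := forall e, Z e \in [:: 0; 1; -1].

(** The flow is the signed indicator of the path, negative on edges traversed backwards. Simplicity
    of the path keeps the coefficients in 0, 1, -1. *)
Lemma path_flow S u s : path (adjacent S) u s -> uniq (u :: s) ->
  exists Z, [/\ unit_coef Z,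
    forall e, Z e != 0 -> [&& e \in S, src e \in u :: s & tgt e \in u :: s]
  & forall v, boundary Z v = (u == v)%:R - (last u s == v)%:R].
Proof.
elim: s u => [|w s IH] u.
  move=> _ _; exists (fun=> 0); split=> [//|e|v]; first by rewrite eqxx.
  by rewrite subrr /boundary big1 // => e _; rewrite mul0r.
move=> /= /andP[/existsP[e0 /andP[e0S e0uw]] ps] /andP[uws us].
have [Z [Zu ZS Zb]] := IH _ ps us.
(* The new edge ends at [u], which the rest of the path avoids. *)
have Ze0 : Z e0 = 0.
  apply/eqP; apply: contraNT uws => /ZS /and3P[_].
  by case/orP: e0uw => /andP[/eqP <- /eqP <-].
pose c : int := if src e0 == u then 1 else -1.
have cn : c \in [:: 0; 1; -1] by rewrite /c; case: ifP.
exists (fun e => Z e + (e == e0)%:R * c); split.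
- by move=> e; case: eqP => [->|_]; rewrite ?Ze0 ?mul1r ?mul0r ?add0r ?addr0.
- move=> e; have [->|_] := eqVneq e e0; last first.
    rewrite mul0r addr0 => /ZS /and3P[-> se te].
    by rewrite [_ \in u :: _]inE se orbT [_ \in u :: _]inE te orbT.
  by move=> _; rewrite e0S; case/orP: e0uw => /andP[/eqP -> /eqP ->];
    rewrite !mem_head inE mem_head orbT.
move=> v; rewrite boundaryD boundary_delta Zb.
rewrite /c; case/orP: e0uw => /andP[/eqP -> /eqP ->]; rewrite ?eqxx; first ring.
have /negbTE -> : w != u by apply: contraNneq uws => ->; rewrite mem_head.
by ring.
Qed.

Lemma connect_flow S u v : connect (adjacent S) u v ->
  exists Z, [/\ unit_coef Z, forall e, e \notin S -> Z e = 0
  & forall w, boundary Z w = (u == w)%:R - (v == w)%:R].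
Proof.
case/connectP => s /shortenP[s' ps' us' _] ->.
have [Z [Zu ZS Zb]] := path_flow ps' us'; exists Z; split=> // e eS.
by apply/eqP; apply: contraNT eS => /ZS /and3P[].
Qed.

Definition is_bridge S e :=
  (e \in S) && ~~ connect (adjacent (S :\ e)) (src e) (tgt e).

(** The edge is closed up by a path from its target to its source that avoids it. *)
Lemma cycle_flow S e : e \in S -> ~~ is_bridge S e ->
  exists Z, [/\ unit_coef Z, forall e', e' \notin S -> Z e' = 0, Z e = 1
  & forall v, boundary Z v = 0].
Proof.
move=> eS; rewrite /is_bridge eS /= negbK.
rewrite (sym_connect_sym (@adjacent_sym _)) => /connect_flow[Z [Zu ZS Zb]].
have Ze : Z e = 0 by apply: ZS; rewrite !inE eqxx.
exists (fun e' => Z e' + (e' == e)%:R * 1); split.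
- by move=> e'; case: eqP => [->|_]; rewrite ?Ze ?mul1r ?mul0r ?addr0.
- move=> e' e'S; rewrite ZS ?inE ?negb_and ?e'S ?orbT //.
  by case: eqP => [e'e|]; rewrite ?mul0r ?addr0 //; rewrite e'e eS in e'S.
- by rewrite Ze eqxx mul1r add0r.
by move=> v; rewrite boundaryD boundary_delta Zb; ring.
Qed.

Definition bridge_side S e := component (S :\ e) (src e).

(** Among the edges of [S], only the bridge crosses the cut around [bridge_side S e]. *)
Lemma bridge_flow S e l : is_bridge S e -> (forall e', e' \notin S -> l e' = 0) ->
  l e = \sum_(v in bridge_side S e) boundary l v.
Proof.
case/andP=> eS nc lS; rewrite sum_boundary (bigD1 e) //= big1 ?addr0.
  by rewrite !inE connect0 (negbTE nc) subr0 mulr1.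
move=> e' e'e; have [e'S|/lS ->] := boolP (e' \in S); last by rewrite mul0r.
by rewrite (@mem_component (S :\ e)) ?subrr ?mulr0 // !inE e'e.
Qed.

Definition spanning S := [forall u, forall v, connect (adjacent S) u v].

(** Each vertex [u] sends [x u] along a path to the root [r], where the total arriving is 0. *)
Lemma spanning_flow S x (r : 'I_p) : spanning S -> \sum_v x v = 0 ->
  exists l, (forall e, e \notin S -> l e = 0) /\ boundary l =1 x.
Proof.
move=> /forallP sp x0.
have /fin_all_exists[Z hZ] (u : 'I_p) : exists Z : 'I_k -> int,
    (forall e, e \notin S -> Z e = 0) /\
    (forall w, boundary Z w = (u == w)%:R - (r == w)%:R).
  have [Z [_ ZS Zb]] := connect_flow (forallP (sp u) r).
  by exists Z.
exists (fun e => \sum_u x u * Z u e); split=> [e eS|v].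
  by rewrite big1 // => u _; rewrite (proj1 (hZ u)) // mulr0.
rewrite boundary_sum; under eq_bigr => u _ do rewrite (proj2 (hZ u)) mulrBr.
rewrite sumrB -mulr_suml x0 mul0r subr0 (bigD1 v) //= eqxx mulr1.
by rewrite big1 ?addr0 // => u /negbTE ->; rewrite mulr0.
Qed.

(** Paths to the root write the identity matrix as a product through dimension [#|S|] plus a matrix
    of rank at most 1; ranks are compared. *)
Lemma spanning_card S (r : 'I_p) : spanning S -> (p <= #|S|.+1)%N.
Proof.
move=> /forallP sp.
have /fin_all_exists[Z hZ] (u : 'I_p) : exists Z : 'I_k -> int,
    (forall e, e \notin S -> Z e = 0) /\
    (forall w, boundary Z w = (u == w)%:R - (r == w)%:R).
  have [Z [_ ZS Zb]] := connect_flow (forallP (sp u) r).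
  by exists Z.
pose M : 'M[rat]_(p, #|S|) := \matrix_(u, i) (Z u (enum_val i))%:~R.
pose N : 'M[rat]_(#|S|, p) := \matrix_(i, w)
  ((src (enum_val i) == w)%:R - (tgt (enum_val i) == w)%:R).
pose J : 'M[rat]_p := const_mx 1 *m (delta_mx 0 r : 'rV_p).
have e1 : 1%:M = M *m N + J.
  apply/matrixP => u w; rewrite !mxE big_ord1 !mxE eqxx /= mul1r.
  have -> : (u == w)%:R = (boundary (Z u) w)%:~R + (r == w)%:R :> rat.
    by rewrite (proj2 (hZ u)) rmorphB /= !mulrz_nat subrK.
  congr (_ + _); last by rewrite eq_sym.
  rewrite /boundary rmorph_sum /= (bigID (mem S)) /= addrC big1 => [|e eS].
    rewrite add0r big_enum_val; apply: eq_bigr => i _; rewrite !mxE rmorphM /=.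
    by rewrite rmorphB /= !mulrz_nat.
  by rewrite (proj1 (hZ u)) // mul0r.
have := mxrank_add (M *m N) J; rewrite -e1 mxrank1 => /leq_trans; apply.
rewrite -addn1; apply: leq_add.
  exact: leq_trans (mxrankM_maxl _ _) (rank_leq_col _).
exact: leq_trans (mxrankM_maxr _ _) (rank_leq_row _).
Qed.

(* [sgn A] is the sign of the wall [sum_A x = 0] on the chamber. *)
Definition generic (sgn : {set 'I_p} -> bool) x :=
  \sum_v x v = 0 /\
  forall A, A != set0 -> A != setT ->
    \sum_(v in A) x v != 0 /\ (0 < \sum_(v in A) x v) = sgn A.

(** A component missing some vertex has no crossing edge, hence net demand 0, which would put [x] on
    a wall. *)
Lemma generic_spanning sgn S x l : generic sgn x ->
  (forall e, e \notin S -> l e = 0) -> boundary l =1 x -> spanning S.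
Proof.
move=> [_ gx] lS bl; apply/forallP => u; apply/forallP => v.
apply: contraT => nuv.
have [||n0 _] := gx (component S u).
- by apply/set0Pn; exists u; rewrite inE connect0.
- by apply: contra nuv => /eqP/setP/(_ v); rewrite !inE.
case/eqP: n0; under eq_bigr => w _ do rewrite -bl.
rewrite sum_boundary big1 // => e _; have [eS|/lS ->] := boolP (e \in S).
  by rewrite (mem_component _ eS) subrr mulr0.
by rewrite mul0r.
Qed.

Section Bounded.

Variable B : nat.
Implicit Types (f : {ffun 'I_k -> 'I_B.+1}).

(** The bound [B] makes the flows a finite type; this condition says that no nonnegative flow with
    boundary [x] is lost. *)
Definition bounded x := forall l, (forall e, 0 <= l e) -> boundary l =1 x ->
  forall e, l e <= B%:Z.

Definition flow_support f := [set e | (0 < f e)%N].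

Definition is_flow x f := [forall v, boundary (fun e => (f e)%:Z) v == x v].

Definition flow_eval (q : {mpoly rat[k]}) f : rat := q.@[fun e => (f e)%:R].

Definition flow_sum S q x : rat :=
  \sum_(f | is_flow x f && (flow_support f == S)) flow_eval q f.

Definition of_int l : {ffun 'I_k -> 'I_B.+1} := [ffun e => inord `|l e|%N].

Lemma of_intE l e : 0 <= l e <= B%:Z -> (of_int l e)%:Z = l e.
Proof. by move=> h; rewrite ffunE inordK; lia. Qed.

(* The nonnegative flows supported in [S] that stay so after adding [Z]. *)
Definition shiftable S Z x f := is_flow x f &&
  [forall e, if e \in S then (Z e != 1) ==> (0 < f e)%N else f e == 0%N :> nat].

(** Edges with coefficient 1 may vanish before the shift, edges with coefficient -1 after it, and
    the remaining edges of [S] stay positive. Boundedness keeps the result in the finite type. *)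
Lemma shiftP S Z x f : unit_coef Z -> (forall e, e \notin S -> Z e = 0) ->
  (forall v, boundary Z v = 0) -> bounded x -> shiftable S Z x f ->
  let g := of_int (fun e => (f e)%:Z + Z e) in
  (forall e, (g e)%:Z = (f e)%:Z + Z e) /\ shiftable S (fun e => - Z e) x g.
Proof.
move=> Zu ZS Zb Bx /andP[/forallP fx /forallP fS] g.
have n0 e : 0 <= (f e)%:Z + Z e.
  move: (fS e) (Zu e) (ZS e); case: ifP => _ h.
    by rewrite !inE => hz _; case/or3P: hz h => /eqP -> /=; lia.
  by move=> _ -> //; lia.
have gx : boundary (fun e => (f e)%:Z + Z e) =1 x.
  by move=> v; rewrite boundaryD Zb addr0 (eqP (fx v)).
have gE e : (g e)%:Z = (f e)%:Z + Z e by rewrite of_intE // n0 /=; exact: (Bx _ n0 gx).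
split=> //; apply/andP; split.
  by apply/forallP => v; rewrite (boundary_ext gE) gx.
apply/forallP => e; move: (gE e) (fS e) (Zu e) (ZS e).
case: ifP => _ ge h.
  by rewrite !inE => hz _; case/or3P: hz h ge => /eqP -> /=; lia.
by move=> _ /(_ isT); move: ge; rewrite (eqP h); lia.
Qed.

Lemma flow_eval_translate Z q f (g : {ffun 'I_k -> 'I_B.+1}) :
  (forall e, (g e)%:Z = (f e)%:Z + Z e) ->
  flow_eval (translate (fun e => (Z e)%:~R) q) f = flow_eval q g.
Proof.
move=> h; rewrite /flow_eval meval_translate; apply: meval_eq => e.
by rewrite -[(g e)%:R]/((g e)%:Z%:~R) h rmorphD.
Qed.

Lemma sum_shift S Z x q : unit_coef Z -> (forall e, e \notin S -> Z e = 0) ->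
  (forall v, boundary Z v = 0) -> bounded x ->
  \sum_(f | shiftable S (fun e => - Z e) x f) flow_eval q f =
  \sum_(f | shiftable S Z x f)
    flow_eval (translate (fun e => (Z e)%:~R) q) f.
Proof.
move=> Zu ZS Zb Bx; pose Z' e := - Z e.
have Zu' : unit_coef Z'.
  by move=> e; move: (Zu e); rewrite !inE /Z' => /or3P[] /eqP ->.
have ZS' e : e \notin S -> Z' e = 0 by move/ZS; rewrite /Z' => ->.
have Zb' v : boundary Z' v = 0 by rewrite boundaryN Zb oppr0.
have P1 f := @shiftP S Z x f Zu ZS Zb Bx.
have P2 f := @shiftP S Z' x f Zu' ZS' Zb' Bx.
rewrite (@sum_bij _ _ _ _ (shiftable S Z x)
  (fun f => of_int (fun e => (f e)%:Z + Z e))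
  (fun f => of_int (fun e => (f e)%:Z + Z' e))).
- apply: eq_bigr => f /P1[hf _]; symmetry; exact: flow_eval_translate.
- move=> f /P2[_ /andP[h1 /forallP h2]]; apply/andP; split=> //.
  by apply/forallP => e; move: (h2 e); rewrite /Z' opprK.
- by move=> f /P1[].
- move=> f /P2[hf hs]; apply/ffunP => e; apply: val_inj.
  have /P1[hg _] : shiftable S Z x (of_int (fun e => (f e)%:Z + Z' e)).
    case/andP: hs => h1 /forallP h2; apply/andP; split=> //.
    by apply/forallP => e'; move: (h2 e'); rewrite /Z' opprK.
  by have := hg e; rewrite hf /Z' subrK => -[].
- move=> f /P1[hf hs]; apply/ffunP => e; apply: val_inj.
  by have [hg _] := P2 _ hs; have := hg e; rewrite hf /Z' addrK => -[].
Qed.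

(** The flows are sorted by exact support: only edges on which [Z] is 1 may drop out of [S]. *)
Lemma sum_shiftable S Z x q :
  \sum_(f | shiftable S Z x f) flow_eval q f =
  \sum_(S' : {set 'I_k} | (S' \subset S) && ([set e in S | Z e != 1] \subset S'))
    flow_sum S' q x.
Proof.
rewrite (partition_big flow_support (fun S' : {set 'I_k} =>
  (S' \subset S) && ([set e in S | Z e != 1] \subset S'))) /=.
  apply: eq_bigr => S' /andP[S'S ZS']; apply: eq_bigl => f.
  rewrite /shiftable -andbA; congr (_ && _).
  apply/andP/idP => [[]//|/eqP fS']; split; last by rewrite fS'.
  have hf e : (0 < f e)%N = (e \in S') by rewrite -fS' inE.
  apply/forallP => e; case: ifP => eS.
    by apply/implyP => ez; rewrite hf; apply: (subsetP ZS'); rewrite inE eS.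
  by rewrite eqn0Ngt hf; apply: contraFN eS; exact: (subsetP S'S).
move=> f /andP[_ /forallP h]; apply/andP; split; apply/subsetP => e.
  by rewrite inE => f0; move: (h e); case: ifP => // _ /eqP fe; rewrite fe in f0.
by rewrite !inE => /andP[eS ez]; move: (h e); rewrite eS ez.
Qed.

Lemma flow_sumD S q r x : flow_sum S (q + r) x = flow_sum S q x + flow_sum S r x.
Proof. by rewrite -big_split; apply: eq_bigr => f _; rewrite /flow_eval mevalD. Qed.

(* The antidifference [A] of [q] along a cycle [Z] turns the sum over a line
   [f + t Z] into the values of [A] at its two ends, where some edge of the
   cycle vanishes; the terms with full support cancel. *)
Lemma flow_sum_cycle S Z x q (A : {mpoly rat[k]}) : unit_coef Z ->
  (forall e, e \notin S -> Z e = 0) -> (forall v, boundary Z v = 0) ->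
  bounded x -> translate (fun e => (Z e)%:~R) A - A = q ->
  flow_sum S q x =
    \sum_(S' : {set 'I_k} | (S' \proper S) && ([set e in S | - Z e != 1] \subset S'))
      flow_sum S' A x
  - \sum_(S' : {set 'I_k} | (S' \proper S) && ([set e in S | Z e != 1] \subset S'))
      flow_sum S' (A + q) x.
Proof.
move=> Zu ZS Zb Bx eA.
have h : \sum_(f | shiftable S Z x f) flow_eval (A + q) f =
    \sum_(f | shiftable S (fun e => - Z e) x f) flow_eval A f.
  by rewrite sum_shift // -eA addrC subrK.
have sp (S' : {set 'I_k}) : (S' \subset S) && (S' != S) = (S' \proper S).
  by rewrite properEneq andbC.
move: h; rewrite !sum_shiftable [LHS](bigD1 S) /=; last first.
  by rewrite subxx; apply/subsetP => e; rewrite inE => /andP[].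
rewrite [RHS](bigD1 S) /=; last first.
  by rewrite subxx; apply/subsetP => e; rewrite inE => /andP[].
under eq_bigl => S' do rewrite andbAC sp.
under [X in _ = _ + X]eq_bigl => S' do rewrite andbAC sp.
rewrite flow_sumD => h; lra.
Qed.

Lemma flow_sum0 S q x :
  (forall f, is_flow x f -> flow_support f != S) -> flow_sum S q x = 0.
Proof. by move=> h; rewrite /flow_sum big_pred0 // => f; apply/andP => -[/h/negP]. Qed.

Lemma flow_off S x f : is_flow x f -> flow_support f = S ->
  (forall e, e \notin S -> (f e)%:Z = 0) /\ boundary (fun e => (f e)%:Z) =1 x.
Proof.
move=> /forallP fx <-; split=> [e|v]; last exact/eqP.
by rewrite inE -eqn0Ngt => /eqP ->.
Qed.

(** A spanning set of bridges is a tree, so the boundary determines the weight of each edge, with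
    the sign of a wall. A wrong sign leaves no flow of support [S]; otherwise there is exactly
    one. *)
Lemma flow_sum_tree (r : 'I_p) sgn S q x :
  generic sgn x -> bounded x -> spanning S ->
  (forall e, e \in S -> is_bridge S e) ->
  flow_sum S q x = if [forall e in S, sgn (bridge_side S e)] then
    q.@[fun e => if e \in S then (\sum_(v in bridge_side S e) x v)%:~R else 0]
  else 0.
Proof.
move=> gx Bx sS br.
have flow_val l : (forall e, e \notin S -> l e = 0) -> boundary l =1 x ->
    forall e, l e = if e \in S then \sum_(v in bridge_side S e) x v else 0.
  move=> l0 lb e; case: ifP => [eS|/negbT/l0//].
  by rewrite (bridge_flow (br e eS) l0); apply: eq_bigr => v _; exact: lb.
have side_pos e : e \in S ->
    (0 < \sum_(v in bridge_side S e) x v) = sgn (bridge_side S e).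
  move=> eS; have /andP[_ nc] := br e eS; apply: (proj2 gx _ _ _).2.
    by apply/set0Pn; exists (src e); rewrite inE connect0.
  by apply: contra nc => /eqP/setP/(_ (tgt e)); rewrite !inE.
case: ifPn => [/forall_inP pos|]; last first.
  rewrite negb_forall_in => /exists_inP[e eS ns]; apply: flow_sum0 => f fx.
  apply: contra ns => /eqP fS; rewrite -side_pos //.
  have [f0 fb] := flow_off fx fS.
  have := flow_val _ f0 fb e; rewrite eS => <-.
  by move: eS; rewrite -fS inE.
have [l [l0 lb]] := spanning_flow r sS (proj1 gx).
have lE := flow_val l l0 lb.
have lpos e : (0 < l e) = (e \in S).
  by rewrite lE; case: ifP => // eS; rewrite side_pos ?pos.
have lge0 e : 0 <= l e.
  by rewrite lE; case: ifP => // eS; rewrite ltW // side_pos ?pos.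
have lB e : (of_int l e)%:Z = l e by rewrite of_intE // lge0 /=; exact: (Bx _ lge0 lb).
have lS : flow_support (of_int l) = S.
  by apply/setP => e; rewrite inE -lpos -lB.
rewrite /flow_sum (big_pred1 (of_int l)) => [|f].
  apply: meval_eq => e; rewrite -[_%:R]/((of_int l e)%:Z%:~R) lB lE.
  by case: ifP.
apply/andP/eqP => [[fx /eqP fS]|->]; last first.
  rewrite lS eqxx; split=> //; apply/forallP => v.
  by rewrite (boundary_ext lB) lb.
have [f0 fb] := flow_off fx fS; apply/ffunP => e; apply: val_inj.
by have := flow_val _ f0 fb e; rewrite -lE -lB => -[].
Qed.

End Bounded.

(** Strong induction on [#|S|]. An antidifference along a cycle raises the degree by one, but every
    resulting support has lost an edge, so [D + #|S|] does not grow. The recursion stops when all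
    edges are bridges: [S] is then a spanning tree, or it carries no flow at all. *)
Theorem flow_sum_poly (r : 'I_p) sgn S (D : nat) (q : {mpoly rat[k]}) :
  (msize q <= D)%N ->
  exists2 P : {mpoly rat[p]}, (msize P <= D + #|S|.+1 - p)%N &
    forall x B, generic sgn x -> bounded B x ->
      flow_sum B S q x = P.@[fun v => (x v)%:~R].
Proof.
have [n] := ubnP #|S|; elim: n S D q => // n IH S D q Sn qD.
have [/forallP br|] := boolP [forall e, (e \in S) ==> is_bridge S e]; last first.
  rewrite negb_forall => /existsP[e]; rewrite negb_imply => /andP[eS nb].
  have [Z [Zu ZS Ze Zb]] := cycle_flow eS nb.
  have ze : (Z e)%:~R * (Z e)%:~R = 1 :> rat by rewrite Ze.
  have [A sA eA] := @antidifference k D (fun e => (Z e)%:~R) q e ze qD.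
  pose good (S' : {set 'I_k}) (G : {mpoly rat[k]}) (P : {mpoly rat[p]}) :=
    (msize P <= D + #|S|.+1 - p)%N /\
    forall x B, generic sgn x -> bounded B x ->
      flow_sum B S' G x = P.@[fun v => (x v)%:~R].
  have sub G : (msize G <= D.+1)%N ->
      exists P, forall S', S' \proper S -> good S' G (P S').
    move=> sG; apply: (@fin_all_exists _ _ (fun S' P => S' \proper S -> good S' G P)).
    move=> S'; have [S'S|] := boolP (S' \proper S); last by exists 0.
    have cS' := proper_card S'S.
    have [||P sP eP] := IH S' D.+1 G; [by lia | by [] |].
    by exists P => _; split=> //; apply: leq_trans sP _; lia.
  have [P1 hP1] := sub A sA.
  have [|P2 hP2] := sub (A + q); first by apply: leq_msizeD => //; exact: leqW.
  exists (\sum_(S' : {set 'I_k} | (S' \proper S) && ([set e in S | - Z e != 1] \subset S')) P1 S'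
    - \sum_(S' : {set 'I_k} | (S' \proper S) && ([set e in S | Z e != 1] \subset S')) P2 S').
    apply: leq_msizeD; rewrite ?msizeN; apply: leq_msize_sum => S' /andP[S'S _].
      exact: (proj1 (hP1 _ S'S)).
    exact: (proj1 (hP2 _ S'S)).
  move=> x B gx Bx; rewrite (flow_sum_cycle Zu ZS Zb Bx eA) mevalB.
  congr (_ - _); rewrite raddf_sum /=; apply: eq_bigr => S' /andP[S'S _].
    exact: (proj2 (hP1 _ S'S)).
  exact: (proj2 (hP2 _ S'S)).
have {}br e : e \in S -> is_bridge S e by move=> eS; exact: (implyP (br e)).
have [sS|nsS] := boolP (spanning S); last first.
  exists 0; first by rewrite msize0.
  move=> x B gx Bx; rewrite meval0; apply: flow_sum0 => f fx.
  apply: contra nsS => /eqP fS; have [f0 fb] := flow_off fx fS.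
  exact: generic_spanning gx f0 fb.
have cS := spanning_card r sS.
(* On a tree the edge weights are linear forms in the demands. *)
pose lq : k.-tuple {mpoly rat[p]} :=
  [tuple if e \in S then \sum_(v in bridge_side S e) 'X_v else 0 | e < k].
exists (if [forall e in S, sgn (bridge_side S e)] then q \mPo lq else 0).
  case: ifP => _; last by rewrite msize0.
  apply: (@leq_trans D); last by lia.
  apply: msize_comp_linear qD => e; rewrite tnth_mktuple.
  case: ifP => _; last by rewrite msize0.
  by apply: leq_msize_sum => v _; rewrite msizeX mdeg1.
move=> x B gx Bx; rewrite (flow_sum_tree r q gx Bx sS br).
case: ifP => _; last by rewrite meval0.
rewrite comp_mpoly_meval; apply: meval_eq => e; rewrite tnth_mktuple.
case: ifP => _; last by rewrite meval0.
rewrite raddf_sum rmorph_sum /=; apply: eq_bigr => v _; by rewrite mevalXU.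
Qed.

End Flows.

(** * Edge weightings of bipartite graphs on a chamber *)

Lemma in_chamber (m n : nat) (c : {pred m.-tuple nat * n.-tuple nat}) mu nu :
  is_chamber c -> (mu, nu) \in c ->
  [/\ forall i, (0 < tnth mu i)%N, forall j, (0 < tnth nu j)%N,
      sumn mu = sumn nu
    & forall IJ, wall_index IJ ->
      (\sum_(i in IJ.1) tnth mu i != \sum_(j in IJ.2) tnth nu j)%N].
Proof.
move=> [_ [side hc]]; rewrite hc => /andP[/and3P[/all_tnthP mu0 /all_tnthP nu0 /eqP e]].
move=> /forallP w; split=> // IJ wIJ; move: (implyP (w IJ) wIJ).
by rewrite /on_side; case: ifP => _; [move/ltn_eqF/negbT | rewrite eq_sym => /ltn_eqF/negbT].
Qed.

Lemma sum_tnth (m : nat) (t : m.-tuple nat) : (\sum_i tnth t i = sumn t)%N.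
Proof. by rewrite sumnE big_tuple. Qed.

Section BipartiteFlows.

Variables (m n k : nat) (c1 : 'I_k -> 'I_m) (c2 : 'I_k -> 'I_n).

Definition fibre_sums (s B : nat) (l : {ffun 'I_k -> 'I_B.+1}) (col : 'I_k -> 'I_s)
  (mu : s.-tuple nat) := [forall i, \sum_(e | col e == i) l e == tnth mu i]%N.

Definition edge_weightings (mu : m.-tuple nat) (nu : n.-tuple nat) :
    {set {ffun 'I_k -> 'I_(sumn mu).+1}} :=
  [set l : {ffun 'I_k -> 'I_(sumn mu).+1} | [&& [forall e, (0 < l e)%N],
    fibre_sums l c1 mu & fibre_sums l c2 nu]].

Definition demand (mu : m.-tuple nat) (nu : n.-tuple nat) (v : 'I_(m + n)) : int :=
  match split v with inl i => (tnth mu i)%:Z | inr j => - (tnth nu j)%:Z end.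

Lemma split_lshift (i : 'I_m) : split (lshift n i) = inl i.
Proof. exact: (unsplitK (inl i)). Qed.

Lemma split_rshift (j : 'I_n) : split (rshift m j) = inr j.
Proof. exact: (unsplitK (inr j)). Qed.

Lemma demand_lshift mu nu i : demand mu nu (lshift n i) = tnth mu i.
Proof. by rewrite /demand split_lshift. Qed.

Lemma demand_rshift mu nu j : demand mu nu (rshift m j) = - (tnth nu j)%:Z.
Proof. by rewrite /demand split_rshift. Qed.

Local Notation src := (fun e => lshift n (c1 e)).
Local Notation tgt := (fun e => rshift m (c2 e)).

Lemma boundary_lshift l i :
  boundary src tgt l (lshift n i) = \sum_(e | c1 e == i) l e.
Proof.
rewrite /boundary [RHS]big_mkcond; apply: eq_bigr => e _ /=.
rewrite eq_rlshift subr0 (inj_eq (@lshift_inj _ _)).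
by case: eqP; rewrite ?mulr1 ?mulr0.
Qed.

Lemma boundary_rshift l j :
  boundary src tgt l (rshift m j) = - \sum_(e | c2 e == j) l e.
Proof.
rewrite /boundary -sumrN [RHS]big_mkcond; apply: eq_bigr => e _ /=.
rewrite eq_lrshift sub0r (inj_eq (@rshift_inj _ _)) mulrN.
by case: eqP; rewrite ?mulr1 ?mulr0 ?oppr0.
Qed.

Lemma natz_sum (I : finType) (P : pred I) (F : I -> nat) :
  (\sum_(i | P i) F i)%N%:Z = \sum_(i | P i) (F i)%:Z.
Proof. by rewrite (big_morph Posz PoszD (erefl 0%:Z)). Qed.

Lemma is_flow_bipartite B (mu : m.-tuple nat) nu (l : {ffun 'I_k -> 'I_B.+1}) :
  is_flow src tgt (demand mu nu) l = fibre_sums l c1 mu && fibre_sums l c2 nu.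
Proof.
have h1 i : (boundary src tgt (fun e => (l e)%:Z) (lshift n i)
      == demand mu nu (lshift n i)) = (\sum_(e | c1 e == i) l e == tnth mu i)%N.
  by rewrite boundary_lshift demand_lshift -natz_sum eqz_nat.
have h2 j : (boundary src tgt (fun e => (l e)%:Z) (rshift m j)
      == demand mu nu (rshift m j)) = (\sum_(e | c2 e == j) l e == tnth nu j)%N.
  by rewrite boundary_rshift demand_rshift -natz_sum eqr_opp eqz_nat.
apply/forallP/andP => [h|[/forallP f1 /forallP f2] v].
  by split; apply/forallP => i; rewrite -?h1 -?h2.
by case: (split_ordP v) => i ->; rewrite ?h1 ?h2.
Qed.

Lemma bounded_bipartite (mu : m.-tuple nat) nu : bounded src tgt (sumn mu) (demand mu nu).
Proof.
move=> l l0 lb e; have := lb (lshift n (c1 e)).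
rewrite boundary_lshift demand_lshift (bigD1 e) //= => h.
apply: (@le_trans _ _ (tnth mu (c1 e))%:Z).
  by rewrite -h lerDl; apply: sumr_ge0 => e' _; exact: l0.
by rewrite lez_nat -sum_tnth (bigD1 (c1 e)) //= leq_addr.
Qed.

Lemma demand_sum (mu : m.-tuple nat) nu (A : {set 'I_(m + n)}) :
  \sum_(v in A) demand mu nu v
  = (\sum_(i in [set i | lshift n i \in A]) tnth mu i)%N%:Z
  - (\sum_(j in [set j | rshift m j \in A]) tnth nu j)%N%:Z.
Proof.
rewrite big_mkcond big_split_ord /= !natz_sum -sumrN; congr (_ + _).
  rewrite [RHS]big_mkcond; apply: eq_bigr => i _.
  by rewrite inE demand_lshift.
rewrite [RHS]big_mkcond; apply: eq_bigr => j _.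
by rewrite inE demand_rshift.
Qed.

(** A vertex set is a pair [(I, J)] of index sets, and its net demand vanishes exactly on the wall
    of that pair. Nonempty proper vertex sets give the admissible pairs. *)
Lemma generic_chamber (c : {pred m.-tuple nat * n.-tuple nat}) :
  is_chamber c ->
  exists sgn, forall mu nu, (mu, nu) \in c -> generic sgn (demand mu nu).
Proof.
move=> hc; have [_ [side cE]] := hc.
pose IJ (A : {set 'I_(m + n)}) :=
  ([set i | lshift n i \in A], [set j | rshift m j \in A]).
(* [side] is true where the sum over [I] is the smaller one, that is, where the demand is negative;
   hence the negation. *)
exists (fun A => ~~ side (IJ A)) => mu nu cmn; split.
  have [_ _ e _] := in_chamber hc cmn.
  transitivity (\sum_(v in [set: 'I_(m + n)]) demand mu nu v).
    by apply: eq_bigl => v; rewrite inE.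
  rewrite demand_sum; apply/eqP; rewrite subr_eq0 eqz_nat; apply/eqP.
  transitivity (sumn mu); [rewrite -sum_tnth|rewrite e -sum_tnth];
    by apply: eq_bigl => i; rewrite !inE.
move=> A A0 AT; have wA : wall_index (IJ A).
  apply/andP; split.
    apply: contra A0 => /eqP[/setP h1 /setP h2]; apply/eqP/setP => v.
    case: (split_ordP v) => i ->; rewrite !inE; first by move: (h1 i); rewrite !inE.
    by move: (h2 i); rewrite !inE.
  apply: contra AT => /eqP[/setP h1 /setP h2]; apply/eqP/setP => v.
  case: (split_ordP v) => i ->; rewrite !inE; first by move: (h1 i); rewrite !inE.
  by move: (h2 i); rewrite !inE.
have [_ _ _ /(_ _ wA) ne] := in_chamber hc cmn.
rewrite demand_sum subr_eq0 eqz_nat subr_gt0 ltz_nat; split=> //.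
move: cmn; rewrite cE => /andP[_ /forallP/(_ (IJ A))]; rewrite wA /= /on_side.
case: (side _) => /= h; last by rewrite h.
by apply/negbTE; rewrite -leqNgt ltnW.
Qed.

(** The count is the sum of the constant 1 over the flows of full support, with size bound [D = 1].
    A left vertex serves as the root. *)
Lemma edge_weightings_poly (c : {pred m.-tuple nat * n.-tuple nat}) :
  (0 < m)%N -> is_chamber c ->
  exists2 P : {mpoly rat[m + n]}, (msize P <= k + 2 - (m + n))%N &
    forall mu nu, (mu, nu) \in c ->
      #|edge_weightings mu nu|%:R = eval_at P mu nu.
Proof.
move=> m0 hc; have [sgn gen] := generic_chamber hc.
have s1 : (msize (1 : {mpoly rat[k]}) <= 1)%N by rewrite msize1.
have [P sP eP] := flow_sum_poly src tgt (lshift n (Ordinal m0)) sgn setT s1.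
(* This passes from demands to parts: the entries of [nu] enter with a minus sign. *)
pose lq : (m + n).-tuple {mpoly rat[m + n]} :=
  [tuple if split v is inl _ then 'X_v else - 'X_v | v < m + n].
exists (P \mPo lq).
  rewrite cardsT card_ord in sP; apply: (@leq_trans (1 + k.+1 - (m + n))).
    apply: msize_comp_linear sP => v; rewrite tnth_mktuple.
    by case: (split v) => _; rewrite ?msizeN msizeX mdeg1.
  lia.
move=> mu nu cmn.
rewrite /eval_at comp_mpoly_meval.
rewrite (@meval_eq _ _ _ (fun v => (demand mu nu v)%:~R)) => [|v]; last first.
  rewrite tnth_mktuple; case: (split_ordP v) => i ->.
    by rewrite mevalXU demand_lshift tnth_lshift.
  by rewrite mevalN mevalXU demand_rshift rmorphN tnth_rshift.
rewrite -(eP _ (sumn mu) (gen _ _ cmn) (@bounded_bipartite mu nu)).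
rewrite -sum1_card natr_sum /flow_sum; apply: eq_big => [l|l _].
  rewrite inE is_flow_bipartite andbC; congr (_ && _).
  apply/forallP/eqP => [h|/setP h e]; last by move: (h e); rewrite !inE.
  by apply/setP => e; rewrite !inE h.
by rewrite /flow_eval meval1.
Qed.

End BipartiteFlows.

Local Close Scope ring_scope.

(** * Labellings and patterns of transpositions *)

(** A labelling of the cycles is encoded as a function on points because, unlike a tuple of cycles,
    it restricts to the marked points. *)
Definition colours (d m : nat) (s : 'S_d) (col : {ffun 'I_d -> 'I_m}) :=
  [forall x, forall y, (col x == col y) == (y \in porbit s x)].

Lemma coloursP (d m : nat) (s : 'S_d) (col : {ffun 'I_d -> 'I_m}) :
  reflect (forall x y, (col x == col y) = (y \in porbit s x)) (colours s col).
Proof.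
apply: (iffP forallP) => [h x y|h x]; first exact: (eqP (forallP (h x) y)).
by apply/forallP => y; rewrite h.
Qed.

Definition colourings (d m : nat) (mu : m.-tuple nat) (s : 'S_d) :=
  [set col : {ffun 'I_d -> 'I_m} |
    colours s col && [forall i, #|[set x | col x == i]| == tnth mu i]].

(** A colouring corresponds to the tuple of its fibres. Positivity of [mu] makes each fibre
    nonempty, hence a cycle. *)
Lemma card_labellings (d m : nat) (mu : m.-tuple nat) (s : 'S_d) :
  (forall i, 0 < tnth mu i) ->
  #|[set L : m.-tuple {set 'I_d} | cycle_labelling mu s L]|
  = #|colourings mu s|.
Proof.
move=> mu0.
pose h (col : {ffun 'I_d -> 'I_m}) := [tuple [set x | col x == i] | i < m].
have h_inj : injective h.
  move=> c c' e; apply/ffunP => x.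
  have := congr1 (fun L : m.-tuple {set 'I_d} => x \in tnth L (c x)) e.
  by rewrite !tnth_mktuple !inE eqxx => /esym/eqP ->.
have sizeE (L : m.-tuple {set 'I_d}) :
    ([seq #|C| | C : {set 'I_d} <- L] == mu)
    = [forall i, #|tnth L i| == tnth mu i].
  have -> : ([seq #|C| | C : {set 'I_d} <- L] == mu)
      = (map_tuple (fun C : {set 'I_d} => #|C|) L == mu) by [].
  apply/eqP/forallP => [<- i|e]; first by rewrite tnth_map.
  by apply: eq_from_tnth => i; rewrite tnth_map (eqP (e i)).
rewrite -(card_imset _ h_inj); congr #|pred_of_set _|; apply/setP => L.
rewrite inE; apply/idP/imsetP => [/andP[pL sL]|[c]]; last first.
  rewrite inE => /andP[/coloursP cs /forallP cm] ->.
  have cls x : [set y | c y == c x] = porbit s x.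
    by apply/setP => y; rewrite inE eq_sym cs.
  have ne i : exists x, c x = i.
    have : 0 < #|[set x | c x == i]| by rewrite (eqP (cm i)).
    by case/card_gt0P => x; rewrite inE => /eqP; exists x.
  apply/andP; split; last first.
    by rewrite sizeE; apply/forallP => i; rewrite tnth_mktuple.
  apply: uniq_perm; rewrite ?enum_uniq //.
    apply/tuple_uniqP => i j; rewrite !tnth_mktuple => e.
    have [x cx] := ne i; have := congr1 (fun A : {set 'I_d} => x \in A) e.
    by rewrite !inE cx eqxx => /esym/eqP.
  move=> A; rewrite mem_enum; apply/tnthP/imsetP => [[i ->]|[x _ ->]].
    by have [x <-] := ne i; exists x; rewrite // tnth_mktuple cls.
  by exists (c x); rewrite tnth_mktuple cls.
have uL : uniq L by rewrite (perm_uniq pL) enum_uniq.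
have mL A : (A \in L) = (A \in porbits s) by rewrite (perm_mem pL) mem_enum.
have LE i x : x \in tnth L i -> tnth L i = porbit s x.
  move=> xi; have : tnth L i \in porbits s by rewrite -mL mem_tnth.
  case/imsetP => y _ e; rewrite e; apply/esym/eqP.
  by rewrite eq_porbit_mem -e.
have /fin_all_exists[c hc] (x : 'I_d) : exists i, x \in tnth L i.
  have : porbit s x \in L by rewrite mL; apply: imset_f.
  by case/tnthP => i e; exists i; rewrite -e porbit_id.
have cE i x : (x \in tnth L i) = (c x == i).
  apply/idP/eqP => [xi|<-]; last exact: hc.
  have /tuple_uniqP := uL; apply.
  by rewrite (LE _ _ (hc x)) (LE _ _ xi).
have eL : L = h (finfun c).
  apply: eq_from_tnth => i; rewrite tnth_mktuple; apply/setP => x.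
  by rewrite inE ffunE cE.
exists (finfun c) => //; rewrite inE; apply/andP; split.
  apply/coloursP => x y; rewrite !ffunE eq_sym -cE.
  by rewrite (LE _ x (hc x)).
by move: sL; rewrite sizeE {1}eL => /forallP sL; apply/forallP => i;
  move: (sL i); rewrite tnth_mktuple.
Qed.

Lemma colourings_inv (d m : nat) (mu : m.-tuple nat) (s : 'S_d) :
  colourings mu s^-1%g = colourings mu s.
Proof.
apply/setP => c; rewrite !inE; congr (_ && _); apply: eq_forallb => x.
by apply: eq_forallb => y; rewrite porbitV.
Qed.

Definition transposition_product (d b : nat) (f : {ffun 'I_b * bool -> 'I_d}) :
  'S_d := (\prod_(i < b) tperm (f (i, true)) (f (i, false)))%g.

(* [f (i, true)] and [f (i, false)] are the entries [r_i > s_i] of [tau_i]. *)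
Definition monotone_entries (e : rel nat) (d b : nat)
    (f : {ffun 'I_b * bool -> 'I_d}) :=
  [forall i, f (i, false) < f (i, true)] &&
  sorted e [seq val (f (i, false)) | i <- enum 'I_b].

Lemma tperm_ltn_inj (d : nat) (r s r' s' : 'I_d) :
  s < r -> s' < r' -> tperm r s = tperm r' s' -> (r = r') * (s = s').
Proof.
move=> sr sr' e.
have h1 : tperm r' s' r = s by rewrite -e tpermL.
have h2 : tperm r' s' s = r by rewrite -e tpermR.
move: h1 h2; case: tpermP => [->|rs'|_ _]; last by move=> rs; rewrite rs ltnn in sr.
  by move=> ->.
by move=> h _; move: sr; rewrite rs' -h ltnNge ltnW.
Qed.

(** A transposition determines its larger and its smaller entry, so the witnesses in
    [monotone_transpositions] are unique and can serve as summation variable. *)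
Lemma sum_monotone (e : rel nat) (d b : nat) (G : 'S_d -> nat) :
  \sum_(tau : b.-tuple 'S_d | monotone_transpositions e tau)
     G (\prod_(i < b) tnth tau i)%g
  = \sum_(f | @monotone_entries e d b f) G (transposition_product f).
Proof.
pose h (f : {ffun 'I_b * bool -> 'I_d}) :=
  [tuple tperm (f (i, true)) (f (i, false)) | i < b].
have sE (s : b.-tuple 'I_d) :
    [seq val (tnth s i) | i <- enum 'I_b] = [seq nat_of_ord x | x <- s].
  by rewrite -[in RHS](map_tnth_enum s) -map_comp.
have hmono f : monotone_entries e f -> monotone_transpositions e (h f).
  move=> /andP[/forallP fr fs].
  apply/existsP; exists [tuple f (i, true) | i < b].
  apply/existsP; exists [tuple f (i, false) | i < b].
  apply/and3P; split.
  - by apply/forallP => i; rewrite !tnth_mktuple.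
  - by apply/forallP => i; rewrite !tnth_mktuple.
  by rewrite -sE; under eq_map => i do rewrite tnth_mktuple.
rewrite [RHS](partition_big h (@monotone_transpositions e d b)) //=.
apply: eq_bigr => tau /existsP[r /existsP[s /and3P[/forallP sr /forallP ht ss]]].
pose f0 : {ffun 'I_b * bool -> 'I_d} :=
  [ffun ib : 'I_b * bool => if ib.2 then tnth r ib.1 else tnth s ib.1].
have hf0 : h f0 = tau.
  by apply: eq_from_tnth => i; rewrite tnth_mktuple !ffunE (eqP (ht i)).
rewrite (big_pred1 f0) => [|f].
  rewrite -hf0 /transposition_product; congr G.
  by apply: eq_bigr => i _; rewrite tnth_mktuple.
apply/andP/eqP => [[/andP[/forallP fr _] /eqP hf]|->]; last first.
  split; last exact/eqP.
  apply/andP; split; first by apply/forallP => i; rewrite !ffunE sr.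
  rewrite -sE in ss; congr (sorted e _): ss.
  by apply: eq_map => i; rewrite ffunE.
apply/ffunP => -[i bb]; move/(congr1 (fun t => tnth t i)): (hf); rewrite -hf0.
rewrite !tnth_mktuple => /tperm_ltn_inj -/(_ (fr i)).
rewrite !ffunE /= => /(_ (sr i)) [h1 h2].
by case: bb; rewrite /= ?h1 ?h2.
Qed.

(** The equation forces [sigma2] to be the inverse of [s * transposition_product f], and inversion
    preserves the cycles as sets. *)
Lemma card_factorisations (e : rel nat) (g m n : nat)
    (mu : m.-tuple nat) (nu : n.-tuple nat) :
  (forall i, 0 < tnth mu i) -> (forall j, 0 < tnth nu j) ->
  #|factorisations e g mu nu|
  = \sum_(f | @monotone_entries e (sumn mu) (2 * g + m + n - 2) f)
    \sum_(s : 'S_(sumn mu)) #|colourings mu s| *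
      #|colourings nu (s * transposition_product f)%g|.
Proof.
move=> mu0 nu0; set d := sumn mu; set b := (_ - _).
rewrite -(sum_monotone e b (fun w => \sum_(s : 'S_d) #|colourings mu s| *
  #|colourings nu (s * w)%g|)).
pose pr (tau : b.-tuple 'S_d) := (\prod_(i < b) tnth tau i)%g.
rewrite -sum1_card.
transitivity (\sum_(s1 : 'S_d) \sum_(tau : b.-tuple 'S_d) \sum_(s2 : 'S_d)
  \sum_(L1 : m.-tuple {set 'I_d}) \sum_(L2 : n.-tuple {set 'I_d})
  ((s1 * pr tau * s2 == 1)%g && (cycle_labelling mu s1 L1 &&
   (cycle_labelling nu s2 L2 && monotone_transpositions e tau)) : nat)).
  rewrite pair_big pair_big pair_big pair_big /= big_mkcond.
  by apply: eq_bigr => -[[[[s1 tau] s2] L1] L2] _; rewrite inE /=; case: (_ && _).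
rewrite exchange_big [RHS]big_mkcond /=; apply: eq_bigr => tau _.
case: ifP => mt; last first.
  rewrite big1 // => s1 _; rewrite big1 // => s2 _.
  rewrite big1 // => L1 _; rewrite big1 // => L2 _. by rewrite !andbF.
apply: eq_bigr => s1 _.
rewrite (bigD1 (s1 * pr tau)^-1%g) //= [X in _ + X]big1 ?addn0; last first.
  move=> s2 hs2; rewrite big1 // => L1 _; rewrite big1 // => L2 _.
  by case: eqP => // /(canRL (mulKg _)); rewrite mulg1 => /eqP; rewrite (negbTE hs2).
rewrite mulgV eqxx -(card_labellings _ mu0) -/(pr tau) -colourings_inv.
rewrite -(card_labellings _ nu0) -!sum1_card big_distrl /= [RHS]big_mkcond.
apply: eq_bigr => L1 _; rewrite inE; case: ifP => _ /=; last by rewrite big1.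
rewrite mul1n [RHS]big_mkcond; apply: eq_bigr => L2 _.
by rewrite inE andbT; case: ifP.
Qed.

(** The bijection is given as a relation, since the correspondences below come as existence and
    uniqueness statements in both directions. *)
Lemma sum_correspondence (V : nmodType) (I J : finType) (R : I -> J -> bool)
    (P : pred I) (Q : pred J) (F : I -> V) (G : J -> V) :
  (forall i, P i -> exists2 j, Q j & R i j) ->
  (forall j, Q j -> exists2 i, P i & R i j) ->
  (forall i j j', R i j -> R i j' -> Q j -> Q j' -> j = j') ->
  (forall i i' j, R i j -> R i' j -> P i -> P i' -> i = i') ->
  (forall i j, P i -> Q j -> R i j -> F i = G j) ->
  (\sum_(i | P i) F i = \sum_(j | Q j) G j)%R.
Proof.
move=> exJ exI unJ unI FG.
transitivity (\sum_(i | P i) \sum_(j | Q j && R i j) F i)%R.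
  apply: eq_bigr => i Pi; have [j Qj Rij] := exJ i Pi.
  rewrite (big_pred1 j) // => j'; apply/andP/eqP => [[Qj' Rij']|-> //].
  exact: unJ Rij' Rij Qj' Qj.
rewrite (exchange_big_dep Q) => [|i j _ /andP[]//] /=.
apply: eq_bigr => j Qj; have [i Pi Rij] := exI j Qj.
rewrite (big_pred1 i) => [|i']; first exact: FG.
apply/andP/eqP => [[Pi' /andP[_ Ri'j]]|->]; last by rewrite Qj.
exact: unI Ri'j Rij Pi' Pi.
Qed.

Section Patterns.

Variables (X : finType) (d : nat).

Definition surjective_ffun (k : nat) (p : {ffun X -> 'I_k}) :=
  [forall a, exists x, p x == a].

Definition relabel (k : nat) (t : k.-tuple 'I_d) (p : {ffun X -> 'I_k}) :
  {ffun X -> 'I_d} := [ffun x => tnth t (p x)].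

Definition increasing (k : nat) (t : k.-tuple 'I_d) := sorted ltn (map val t).

Lemma increasing_mono (k : nat) (t : k.-tuple 'I_d) :
  increasing t -> {mono tnth t : i j / i <= j}.
Proof.
move=> st; have h (i : 'I_k) : val (tnth t i) = nth 0 (map val t) i.
  by rewrite (nth_map (tnth t i)) ?size_tuple // -tnth_nth.
have lt (i j : 'I_k) : i < j -> tnth t i < tnth t j.
  by move=> ij; rewrite !h (sorted_ltn_nth ltn_trans) ?inE ?size_map ?size_tuple.
move=> i j; case: (ltngtP i j) => [/lt/ltnW -> //|/lt|/val_inj ->].
  by rewrite ltnNge => /negbTE.
exact: leqnn.
Qed.

Lemma increasing_inj (k : nat) (t : k.-tuple 'I_d) :
  increasing t -> injective (tnth t).
Proof.
move=> /increasing_mono tm i j e; apply: val_inj; apply/eqP.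
by rewrite eqn_leq -2!tm e leqnn.
Qed.

Lemma sorted_enum_set (A : {set 'I_d}) : sorted ltn (map val (enum A)).
Proof.
rewrite sorted_map; apply: sorted_filter.
  by move=> a b c; exact: ltn_trans.
by rewrite -sorted_map -enumT val_enum_ord iota_ltn_sorted.
Qed.

Lemma relabel_image (k : nat) (t : k.-tuple 'I_d) (p : {ffun X -> 'I_k}) :
  surjective_ffun p -> relabel t p @: setT =i t.
Proof.
move=> /forallP sp y; apply/imsetP/tnthP => [[x _ ->]|[a ->]].
  by exists (p x); rewrite ffunE.
by have /existsP[x /eqP xa] := sp a; exists x; rewrite ?ffunE ?xa.
Qed.

(** A function factors uniquely as a surjection onto the ranks of its values, its pattern, followed
    by the increasing enumeration of these values. *)
Lemma sum_patterns_card (V : nmodType) (k : nat) (F : {ffun X -> 'I_d} -> V) :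
  (\sum_(f : {ffun X -> 'I_d} | #|f @: setT| == k) F f
  = \sum_(p : {ffun X -> 'I_k} | surjective_ffun p)
      \sum_(t : k.-tuple 'I_d | increasing t) F (relabel t p))%R.
Proof.
rewrite pair_big /=.
apply: (@sum_correspondence V _ _
  (fun f (pt : {ffun X -> 'I_k} * k.-tuple 'I_d) => f == relabel pt.2 pt.1)).
- move=> f /eqP fk; case: k / fk.
  pose A := f @: setT; pose t := enum_tuple (mem A).
  have /fin_all_exists[p hp] (x : X) : exists a, f x = tnth t a.
    by apply/tnthP; rewrite mem_enum imset_f.
  exists (finfun p, t); last first.
    by apply/eqP/ffunP => x; rewrite !ffunE.
  rewrite /= /increasing sorted_enum_set andbT; apply/forallP => a.
  have : tnth t a \in A by rewrite -mem_enum mem_tnth.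
  case/imsetP => x _ e; apply/existsP; exists x; rewrite ffunE; apply/eqP.
  have /tuple_uniqP : uniq t by rewrite enum_uniq.
  by apply; rewrite -hp e.
- move=> [p t] /andP[sp st]; exists (relabel t p) => //=.
  have -> : relabel t p @: setT = [set x in t].
    by apply/setP => y; rewrite relabel_image // inE.
  rewrite cardsE; apply/eqP; rewrite -[RHS](size_tuple t).
  apply/card_uniqP; apply/tuple_uniqP; exact: increasing_inj.
- move=> f [p t] [p' t'] /= /eqP e /eqP e' /andP[sp st] /andP[sp' st'].
  have tt' : t = t'.
    apply: val_inj; apply: (inj_map val_inj).
    apply: (irr_sorted_eq ltn_trans ltnn st st') => y.
    have mt : t =i t'.
      by move=> z; rewrite -(relabel_image t sp) -e e' relabel_image.
    by apply/mapP/mapP => -[z zt ->]; exists z; rewrite // ?mt // -mt.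
  congr (_, _) => //; apply/ffunP => x; apply: (increasing_inj st).
  by move: e; rewrite e' -tt' => /ffunP/(_ x); rewrite !ffunE.
- by move=> f f' [p t] /eqP -> /eqP ->.
by move=> f [p t] _ _ /eqP ->.
Qed.

Lemma sum_patterns (V : nmodType) (F : {ffun X -> 'I_d} -> V) :
  (\sum_f F f = \sum_(k < #|X|.+1)
    \sum_(p : {ffun X -> 'I_k} | surjective_ffun p)
      \sum_(t : k.-tuple 'I_d | increasing t) F (relabel t p))%R.
Proof.
rewrite (partition_big (fun f : {ffun X -> 'I_d} =>
  inord #|f @: setT| : 'I_#|X|.+1) predT) //=.
apply: eq_bigr => k _; rewrite -sum_patterns_card; apply: eq_bigl => f.
rewrite -val_eqE /= inordK // ltnS.
by apply: leq_trans (leq_imset_card _ _) _; rewrite cardsT.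
Qed.

End Patterns.

(** * Conjugation invariance and injections of the marked points *)

Lemma perm_extension (T : finType) (A : finType) (f f' : A -> T) :
  injective f -> injective f' -> exists s : {perm T}, forall a, s (f a) = f' a.
Proof.
move=> fI f'I.
(* Each image is continued to an enumeration of [T] by its complement; matching positions in the two
   enumerations gives the permutation. *)
pose ext (h : A -> T) := codom h ++ [seq x <- enum T | x \notin codom h].
have ext_perm (h : A -> T) : injective h -> perm_eq (ext h) (enum T).
  move=> hI; apply: uniq_perm; rewrite ?enum_uniq //.
    rewrite cat_uniq filter_uniq ?enum_uniq // andbT /codom map_inj_uniq //.
    rewrite enum_uniq /=; apply/hasPn => x; rewrite mem_filter => /andP[].
    by [].
  by move=> x; rewrite mem_cat mem_filter mem_enum andbT; case: (x \in codom h).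
have mem_ext h x : injective h -> x \in ext h.
  by move=> /ext_perm/perm_mem ->; rewrite mem_enum.
have size_ext h : injective h -> size (ext h) = size (enum T).
  by move=> /ext_perm/perm_size.
have [T0|/card_gt0P[x0 _]] := posnP #|T|.
  by exists 1%g => a; have := card0_eq T0 (f a).
pose g x := nth x0 (ext f') (index x (ext f)).
have gI : injective g.
  move=> x y /eqP; rewrite nth_uniq.
  - by move=> /eqP /(@index_inj _ x0 (ext f) x y (mem_ext f x fI) (mem_ext f y fI)).
  - by rewrite (size_ext f') // -(size_ext f) // index_mem mem_ext.
  - by rewrite (size_ext f') // -(size_ext f) // index_mem mem_ext.
  by rewrite (perm_uniq (ext_perm f' f'I)) enum_uniq.
exists (perm gI) => a; rewrite permE /g /ext index_cat codom_f.
have ia : index (f a) (codom f) = index a (enum A) by rewrite index_map.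
rewrite ia nth_cat size_codom cardE index_mem mem_enum /=.
by rewrite (nth_map a) ?index_mem ?nth_index ?mem_enum.
Qed.

Lemma transposition_product_perm (d b : nat) (g : 'S_d)
    (f : {ffun 'I_b * bool -> 'I_d}) :
  transposition_product [ffun x => g (f x)] = (transposition_product f ^ g)%g.
Proof.
rewrite conjg_prod; apply: eq_bigr => i _.
by rewrite tpermJ !ffunE.
Qed.

Lemma porbit_conj (d : nat) (s g : 'S_d) x y :
  (g y \in porbit (s ^ g)%g (g x)) = (y \in porbit s x).
Proof.
apply/porbitP/porbitP => [[i]|[i ->]]; exists i.
  by move: p; rewrite -conjXg permJ => /perm_inj.
by rewrite -conjXg permJ.
Qed.

Lemma card_colourings_conj (d m : nat) (mu : m.-tuple nat) (s g : 'S_d) :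
  #|colourings mu (s ^ g)%g| = #|colourings mu s|.
Proof.
have le (t h : 'S_d) : #|colourings mu (t ^ h)%g| <= #|colourings mu t|.
  pose phi (c : {ffun 'I_d -> 'I_m}) : {ffun 'I_d -> 'I_m} :=
    [ffun x => c (h x)].
  have phiI : injective phi.
    move=> c c' e; apply/ffunP => x; move/ffunP/(_ (h^-1%g x)): e.
    by rewrite !ffunE permKV.
  rewrite -(card_imset _ phiI); apply: subset_leq_card.
  apply/subsetP => _ /imsetP[c ct ->].
  move: ct; rewrite !inE => /andP[/coloursP ct /forallP cm].
  apply/andP; split.
    by apply/coloursP => x y; rewrite !ffunE ct porbit_conj.
  apply/forallP => i; rewrite -(eqP (cm i)); apply/eqP.
  rewrite -(card_imset _ (@perm_inj _ h)); congr #|pred_of_set _|.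
  apply/setP => y; rewrite inE; apply/imsetP/idP => [[x]|yi].
    by rewrite inE ffunE => xi ->.
  by exists (h^-1%g y); rewrite ?permKV // inE ffunE permKV.
by apply/eqP; rewrite eqn_leq le /= -{1}(conjgK g s).
Qed.

Section Weights.

Variables (d m n : nat) (mu : m.-tuple nat) (nu : n.-tuple nat).

Definition pair_count (w : 'S_d) :=
  \sum_(s : 'S_d) #|colourings mu s| * #|colourings nu (s * w)%g|.

Lemma pair_count_conj (w g : 'S_d) : pair_count (w ^ g)%g = pair_count w.
Proof.
rewrite /pair_count (reindex_inj (conjg_inj g)) /=; apply: eq_bigr => s _.
by rewrite -conjMg (card_colourings_conj mu s g) (card_colourings_conj nu _ g).
Qed.

(** Any two injections differ by a permutation of the points, so by conjugation invariance all terms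
    are equal. It remains to see that there are [k] factorial times as many injections as increasing
    tuples. *)
Lemma sum_increasing (b k : nat) (p : {ffun 'I_b * bool -> 'I_k}) :
  (\sum_(t : k.-tuple 'I_d | increasing t)
     pair_count (transposition_product (relabel t p))) * k`!
  = \sum_(i : {ffun 'I_k -> 'I_d} | injectiveb i)
     pair_count (transposition_product [ffun x => i (p x)]).
Proof.
have [nle|le] := ltnP d k.
  rewrite big_pred0 => [|t]; last first.
    apply: contraTF nle => /increasing_inj/leq_card.
    by rewrite !card_ord -leqNgt.
  rewrite mul0n big_pred0 // => i.
  by apply: contraTF nle => /injectiveP/leq_card; rewrite !card_ord -leqNgt.
have [i0 i0I] : exists i : {ffun 'I_k -> 'I_d}, injective i.
  exists [ffun a => widen_ord le a] => a a'.
  by rewrite !ffunE => /(congr1 val) /= /val_inj.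
pose W := pair_count (transposition_product [ffun x => i0 (p x)]).
have inv (i : 'I_k -> 'I_d) : injective i ->
    pair_count (transposition_product [ffun x => i (p x)]) = W.
  move=> iI; have [g hg] := perm_extension iI i0I.
  rewrite /W -(pair_count_conj _ g) -transposition_product_perm.
  congr (pair_count (transposition_product _)).
  by apply/ffunP => x; rewrite !ffunE hg.
rewrite (eq_bigr (fun=> W)) => [|t /increasing_inj]; last exact: inv.
rewrite [RHS](eq_bigr (fun=> W)) => [|i /injectiveP]; last exact: inv.
rewrite !sum_nat_const mulnAC; congr (_ * _).
have -> : #|[pred t : k.-tuple 'I_d | increasing t]| = 'C(d, k).
  by rewrite -card_ltn_sorted_tuples; apply: eq_card => t; rewrite !inE.
rewrite bin_ffact -[in LHS](card_ord d) -[in LHS](card_ord k) -card_inj_ffuns.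
by apply: eq_card => t; rewrite !inE.
Qed.

End Weights.

Lemma monotone_relabel (e : rel nat) (d b k : nat) (t : k.-tuple 'I_d)
    (p : {ffun 'I_b * bool -> 'I_k}) :
  (forall i j : 'I_k, e (tnth t i) (tnth t j) = e i j) ->
  increasing t -> monotone_entries e (relabel t p) = monotone_entries e p.
Proof.
move=> et st; rewrite /monotone_entries; congr (_ && _).
  by apply: eq_forallb => i; rewrite !ffunE !ltnNge increasing_mono.
rewrite !sorted_map; apply: eq_sorted => i j /=.
by rewrite !ffunE et.
Qed.

(** * First return to the marked points *)

Section Suspension.

Variables (d k : nat).
Implicit Types (psi : {ffun 'I_d -> 'I_k * 'I_d}) (l : {ffun 'I_k -> 'I_d.+1})
  (sb : 'S_k) (s : 'S_d) (i : {ffun 'I_k -> 'I_d}).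

(* [psi] identifies ['I_d] with the set of pairs [(a, j)] with [j < l a]. *)
Definition chart l psi := [&& [forall a, 0 < l a], \sum_a l a == d,
  injectiveb psi & [forall x, (psi x).2 < l (psi x).1]].

(* [s] climbs the tower [(a, 0), (a, 1), ...] over [a] and then jumps from its
   top to the bottom of the tower over [sb a]. *)
Definition suspension psi l sb s := [forall x,
  if (psi x).2.+1 < l (psi x).1
  then ((psi (s x)).1 == (psi x).1) && ((psi (s x)).2 == (psi x).2.+1 :> nat)
  else ((psi (s x)).1 == sb (psi x).1) && ((psi (s x)).2 == 0 :> nat)].

Definition based i psi := [forall a, ((psi (i a)).1 == a) && ((psi (i a)).2 == 0 :> nat)].

Definition marked i s :=
  injectiveb i && [forall x, [exists a, i a \in porbit s x]].

Definition blocks l : {set 'I_k * 'I_d} := [set y : 'I_k * 'I_d | y.2 < l y.1].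

Lemma card_lt_ord (c : nat) : c <= d -> #|[set j : 'I_d | j < c]| = c.
Proof.
move=> cd; rewrite -sum1dep_card.
by rewrite -(big_ord_widen d (fun=> 1) cd) sum1_card card_ord.
Qed.

Lemma card_blocks l : #|blocks l| = \sum_a l a.
Proof.
rewrite -sum1dep_card.
rewrite -(pair_big_dep predT (fun a (j : 'I_d) => j < l a) (fun _ _ => 1)) /=.
by apply: eq_bigr => a _; rewrite sum1dep_card card_lt_ord // -ltnS.
Qed.

(** A chart is an injection of the [d] points into [blocks l], which has [d] elements. *)
Lemma card_charts l : (forall a, 0 < l a) -> \sum_a l a = d ->
  #|[set psi | chart l psi]| = d`!.
Proof.
move=> l0 ld.
have := card_inj_ffuns_on 'I_d (mem (blocks l)).
rewrite card_blocks ld card_ord ffactnn => <-.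
apply: eq_card => psi; rewrite !inE /chart ld eqxx.
have -> : [forall a, 0 < l a] by apply/forallP.
rewrite /= andbC; congr (_ && _); apply/forallP/ffun_onP => h x.
  by rewrite inE.
by have := h x; rewrite inE.
Qed.

Section Chart.

Variables (psi : {ffun 'I_d -> 'I_k * 'I_d}) (l : {ffun 'I_k -> 'I_d.+1}).
Hypothesis psi_chart : chart l psi.

Lemma chart_pos a : 0 < l a.
Proof. by case/and4P: psi_chart => /forallP. Qed.

Lemma chart_inj x y :
  (psi x).1 = (psi y).1 -> (psi x).2 = (psi y).2 :> nat -> x = y.
Proof.
case/and4P: psi_chart => _ _ /injectiveP I _ h1 h2; apply: I.
move: h1 h2; case: (psi x) (psi y) => [a j] [a' j'] /= -> h.
by congr (_, _); exact: val_inj.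
Qed.

Lemma chart_lt x : (psi x).2 < l (psi x).1.
Proof. by case/and4P: psi_chart => _ _ _ /forallP. Qed.

Lemma chart_image : psi @: setT = blocks l.
Proof.
case/and4P: psi_chart => _ /eqP ld /injectiveP I _.
apply/eqP; rewrite eqEcard card_blocks ld card_imset // cardsT card_ord leqnn andbT.
by apply/subsetP => _ /imsetP[x _ ->]; rewrite inE chart_lt.
Qed.

Lemma chart_surj a (j : nat) : j < l a ->
  exists2 x, (psi x).1 = a & (psi x).2 = j :> nat.
Proof.
move=> jl; have jd : j < d by apply: leq_trans jl _; rewrite -ltnS.
have : (a, Ordinal jd) \in blocks l by rewrite inE.
by rewrite -chart_image => /imsetP[x _ e]; exists x; rewrite -e.
Qed.

Lemma chart_base : exists i, based i psi.
Proof.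
have /fin_all_exists[i hi] (a : 'I_k) :
    exists x, ((psi x).1 == a) && ((psi x).2 == 0 :> nat).
  by have [x h1 h2] := chart_surj (chart_pos a); exists x; rewrite h1 h2 !eqxx.
by exists (finfun i); apply/forallP => a; rewrite ffunE.
Qed.

Lemma card_chart_fibre a : #|[set x | (psi x).1 == a]| = l a.
Proof.
case/and4P: psi_chart => _ _ /injectiveP I _.
rewrite -(card_imset _ I).
have -> : psi @: [set x | (psi x).1 == a] = setX [set a] [set j : 'I_d | j < l a].
  apply/setP => -[b j]; rewrite !inE; apply/imsetP/andP => [[x]|[/= /eqP -> jl]].
    rewrite inE => /eqP xa e; have := chart_lt x; rewrite xa -e /= => jl.
    by rewrite jl -xa -e eqxx.
  have [x h1 h2] := chart_surj jl; exists x; first by rewrite inE h1.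
  by move: h1 h2; case: (psi x) => a' j' /= -> h; congr (_, _); exact: val_inj.
by rewrite cardsX cards1 mul1n card_lt_ord // -ltnS.
Qed.

Section Orbits.

Variables (sb : 'S_k) (s : 'S_d) (i : {ffun 'I_k -> 'I_d}).
Hypotheses (psi_susp : suspension psi l sb s) (psi_base : based i psi).

Lemma base1 a : (psi (i a)).1 = a.
Proof. by have /andP[/eqP] := forallP psi_base a. Qed.

Lemma base2 a : (psi (i a)).2 = 0 :> nat.
Proof. by have /andP[_ /eqP] := forallP psi_base a. Qed.

Lemma step_up x : (psi x).2.+1 < l (psi x).1 ->
  (psi (s x)).1 = (psi x).1 /\ (psi (s x)).2 = (psi x).2.+1 :> nat.
Proof. by have := forallP psi_susp x; case: ifP => // _ /andP[/eqP -> /eqP ->]. Qed.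

Lemma step_jump x : ((psi x).2.+1 < l (psi x).1) = false -> s x = i (sb (psi x).1).
Proof.
move=> h; have := forallP psi_susp x; rewrite h => /andP[/eqP h1 /eqP h2].
by apply: chart_inj; rewrite ?h1 ?h2 ?base1 ?base2.
Qed.

Lemma porbit_step x : porbit s (s x) = porbit s x.
Proof. by have := porbit_perm s 1 x; rewrite expg1. Qed.

Lemma porbit_base x : porbit s x = porbit s (i (psi x).1).
Proof.
have [j] := ubnP (psi x).2; elim: j x => // j IH x; rewrite ltnS => xj.
case E : (val (psi x).2) => [|j'].
  congr (porbit s); apply: chart_inj; rewrite ?base1 ?base2 //.
have lx := chart_lt x.
have [y y1 y2] : exists2 y, (psi y).1 = (psi x).1 & (psi y).2 = j' :> nat.
  by apply: chart_surj; apply: leq_trans lx; rewrite E.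
have [|h1 h2] := @step_up y; first by rewrite y1 y2 -E.
have sy : s y = x by apply: chart_inj; rewrite ?h1 ?h2 ?y1 ?y2 ?E.
rewrite -sy porbit_step h1; apply: IH.
by rewrite y2 -[_ < _]/(j'.+1 <= j) -E.
Qed.

Lemma porbit_jump a : porbit s (i (sb a)) = porbit s (i a).
Proof.
have la := chart_pos a.
have [x x1 x2] : exists2 x, (psi x).1 = a & (psi x).2 = (l a).-1 :> nat.
  by apply: chart_surj; rewrite prednK.
have -> : porbit s (i a) = porbit s x by rewrite (porbit_base x) x1.
by rewrite -[RHS]porbit_step (@step_jump x) x1 // x2 prednK // ltnn.
Qed.

(** Climbing stays in a tower and jumping follows [sb], so the cycles of [s] are those of its first
    return map with the towers attached. *)
Lemma mem_porbit_suspension x y :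
  (y \in porbit s x) = ((psi y).1 \in porbit sb (psi x).1).
Proof.
apply/idP/idP => [/porbitP[c ->]|/porbitP[c e]].
  elim: c => [|c IH]; first by rewrite perm1 porbit_id.
  rewrite expgSr permM; set z := (s ^+ c)%g x in IH *.
  case E : ((psi z).2.+1 < l (psi z).1); first by rewrite (step_up E).1.
  rewrite step_jump // base1 -eq_porbit_mem.
  move: IH; rewrite -eq_porbit_mem => /eqP <-.
  by have := porbit_perm sb 1 (psi z).1; rewrite expg1 => ->.
rewrite -eq_porbit_mem (porbit_base y) (porbit_base x) e.
apply/eqP; elim: c {e} => [|c IH]; first by rewrite perm1.
by rewrite expgSr permM porbit_jump.
Qed.

Lemma suspension_marked : marked i s.
Proof.
apply/andP; split.
  by apply/injectiveP => a a' e; rewrite -(base1 a) e base1.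
apply/forallP => x; apply/existsP; exists (psi x).1.
by rewrite -eq_porbit_mem -porbit_base.
Qed.

Definition small_colourings (m : nat) (mu : m.-tuple nat) :=
  [set c : {ffun 'I_k -> 'I_m} | colours sb c && fibre_sums l c mu].

(** A colouring is constant along towers, hence pulled back from the marked points, and the size of
    a colour class is the total height of its towers. *)
Lemma card_colourings_suspension (m : nat) (mu : m.-tuple nat) :
  #|colourings mu s| = #|small_colourings mu|.
Proof.
pose h (c : {ffun 'I_k -> 'I_m}) : {ffun 'I_d -> 'I_m} := [ffun x => c (psi x).1].
have hI : injective h.
  move=> c c' /ffunP e; apply/ffunP => a; have := e (i a).
  by rewrite !ffunE base1.
have fib (c : {ffun 'I_k -> 'I_m}) j :
    #|[set x | h c x == j]| = \sum_(a | c a == j) l a.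
  rewrite -sum1dep_card (partition_big (fun x => (psi x).1) (fun a => c a == j)) /=.
    apply: eq_bigr => a /eqP ca; rewrite -card_chart_fibre -sum1dep_card.
    apply: eq_bigl => x; rewrite ffunE andbC.
    by have [->|//] := eqVneq (psi x).1 a; rewrite ca eqxx.
  by move=> x; rewrite ffunE.
rewrite -(card_imset _ hI); congr #|pred_of_set _|; apply/setP => c.
apply/idP/imsetP => [|[cb]]; rewrite inE => /andP[/coloursP cs /forallP cm].
  have ch : c = h [ffun a => c (i a)].
    apply/ffunP => x; rewrite !ffunE; apply/eqP.
    by rewrite cs mem_porbit_suspension base1 porbit_id.
  exists [ffun a => c (i a)] => //; rewrite inE; apply/andP; split.
    by apply/coloursP => a a'; rewrite !ffunE cs mem_porbit_suspension !base1.
  by apply/forallP => j; rewrite -fib -ch.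
move=> ->; rewrite inE; apply/andP; split.
  by apply/coloursP => x y; rewrite !ffunE cs -mem_porbit_suspension.
by apply/forallP => j; rewrite fib.
Qed.

(** [w] moves only marked points, which [s] reaches only by jumps; so the heights stay, and the
    return map is followed by [wb]. *)
Lemma suspension_mul (w : 'S_d) (wb : 'S_k) :
  (forall a, w (i a) = i (wb a)) -> (forall x, x \notin codom i -> w x = x) ->
  suspension psi l (sb * wb)%g (s * w)%g.
Proof.
move=> wi w0; apply/forallP => x; rewrite !permM.
case: ifP => [h|/step_jump ->]; last by rewrite wi base1 base2 !eqxx.
have [h1 h2] := step_up h; rewrite w0 ?h1 ?h2 ?eqxx //.
by apply/negP => /codomP[a e]; move: h2; rewrite e base2.
Qed.

End Orbits.

Lemma suspension_exists sb : exists i s, based i psi && suspension psi l sb s.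
Proof.
have [i ib] := chart_base; exists i.
pose target x (z : 'I_d) := if (psi x).2.+1 < l (psi x).1
  then ((psi z).1 == (psi x).1) && ((psi z).2 == (psi x).2.+1 :> nat)
  else ((psi z).1 == sb (psi x).1) && ((psi z).2 == 0 :> nat).
have /fin_all_exists[f hf] (x : 'I_d) : exists z, target x z.
  rewrite /target; have [h|h] := ltnP (psi x).2.+1 (l (psi x).1).
    by have [z h1 h2] := chart_surj h; exists z; rewrite h1 h2 !eqxx.
  by exists (i (sb (psi x).1)); rewrite base1 // base2 // !eqxx.
have fI : injective f.
  move=> x y e; move: (hf x) (hf y); rewrite /target -e.
  case: ifP => hx; case: ifP => hy /andP[/eqP x1 /eqP x2] /andP[/eqP y1 /eqP y2].
  - by apply: chart_inj; rewrite -?x1 -?y1 //; apply: succn_inj; rewrite -x2 -y2.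
  - by move: x2; rewrite y2.
  - by move: y2; rewrite x2.
  have xy : (psi x).1 = (psi y).1 by apply: (@perm_inj _ sb); rewrite -x1 -y1.
  apply: chart_inj => //; apply: succn_inj.
  move: hx hy (chart_lt x) (chart_lt y); rewrite xy.
  move/negbT; rewrite -leqNgt => a1 /negbT; rewrite -leqNgt => a2 a3 a4.
  by apply/eqP; rewrite eqn_leq (leq_trans a3 a2) (leq_trans a4 a1).
exists (perm fI); rewrite ib; apply/forallP => x; rewrite permE; exact: hf.
Qed.

Lemma suspension_unique sb i s i' s' : based i psi -> suspension psi l sb s ->
  based i' psi -> suspension psi l sb s' -> (i, s) = (i', s').
Proof.
move=> b h b' h'; have ei : i = i'.
  by apply/ffunP => a; apply: chart_inj; rewrite ?(base1 b) ?(base1 b') ?(base2 b) ?(base2 b').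
congr (_, _) => //; apply/permP => x.
case E : ((psi x).2.+1 < l (psi x).1).
  have [h1 h2] := step_up h E; have [h1' h2'] := step_up h' E.
  by apply: chart_inj; rewrite ?h1 ?h2 ?h1' ?h2'.
by rewrite (step_jump h b E) (step_jump h' b' E) ei.
Qed.

End Chart.

End Suspension.

(** * Existence and uniqueness of the chart of a marked permutation *)

Lemma downward_closed_set (d : nat) (A : {set 'I_d}) :
  (forall j j' : 'I_d, j' <= j -> j \in A -> j' \in A) ->
  A = [set j : 'I_d | j < #|A|].
Proof.
move=> dc; have cA : #|A| <= d by rewrite -[X in _ <= X]card_ord max_card.
apply/eqP; rewrite eqEcard card_lt_ord // leqnn andbT.
apply/subsetP => j jA; rewrite inE -[X in X <= _](card_lt_ord (ltn_ord j)).
by apply: subset_leq_card; apply/subsetP => j'; rewrite inE ltnS => /dc; apply.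
Qed.

Section MarkedPermutations.

Variables (d k : nat).
Implicit Types (psi : {ffun 'I_d -> 'I_k * 'I_d}) (l : {ffun 'I_k -> 'I_d.+1})
  (sb : 'S_k) (s : 'S_d) (i : {ffun 'I_k -> 'I_d}).

(** The chart sends [x] to the first marked point met when going backwards from [x], together with
    the number of steps taken; [l] is the return time and [sb] the first return map. *)
Lemma chart_exists i s : marked i s -> exists psi l sb,
  [/\ chart l psi, based i psi & suspension psi l sb s].
Proof.
move=> /andP[/injectiveP iI /forallP im]; pose V := (s^-1)%g.
pose hit x (q : 'I_k * 'I_d) := iter q.2 V x = i q.1 /\
  forall j, j < q.2 -> iter j V x \notin codom i.
have /fin_all_exists[f hf] (x : 'I_d) : exists q, hit x q.
  (* Fewer than [d] steps suffice, as the cycle of [x] has at most [d] points. *)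
  have ex : exists j, (iter j V x \in codom i) && (j < d).
    have /existsP[a] := im x; rewrite -porbitV porbit_traject => /trajectP[j jl e].
    exists j; rewrite -e codom_f /=; apply: leq_trans jl _.
    by rewrite -[X in _ <= X]card_ord max_card.
  case: (ex_minnP ex) => j /andP[/codomP[a e] jd] jmin.
  exists (a, Ordinal jd); split=> //= j' j'j; apply/negP => h.
  by have := jmin j'; rewrite h (ltn_trans j'j jd) leqNgt j'j => /(_ isT).
pose psi : {ffun 'I_d -> 'I_k * 'I_d} := finfun f.
have hit_psi x : hit x (psi x) by rewrite ffunE.
have uniq_hit x a j : iter j V x = i a ->
    (forall j', j' < j -> iter j' V x \notin codom i) ->
    (psi x).1 = a /\ (psi x).2 = j :> nat.
  have [h1 h2] := hit_psi x; move=> e h.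
  have ej : (psi x).2 = j :> nat.
    case: (ltngtP (psi x).2 j) => // [/h|/h2]; first by rewrite h1 codom_f.
    by rewrite e codom_f.
  by split=> //; apply: iI; rewrite -h1 ej.
have psi0 a : (psi (i a)).1 = a /\ (psi (i a)).2 = 0 :> nat.
  exact: uniq_hit.
have psiS x : s x \notin codom i ->
    (psi (s x)).1 = (psi x).1 /\ (psi (s x)).2 = (psi x).2.+1 :> nat.
  move=> sx; have [h1 h2] := hit_psi x; apply: uniq_hit.
    by rewrite iterSr permK.
  by case=> [|j'] //; rewrite ltnS => /h2; rewrite iterSr permK.
have psiP x j : (psi x).2 = j.+1 :> nat ->
    (psi (V x)).1 = (psi x).1 /\ (psi (V x)).2 = j :> nat.
  move=> xj; have [h1 h2] := hit_psi x; apply: uniq_hit.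
    by rewrite -iterSr -xj.
  by move=> j' j'j; rewrite -iterSr; apply: h2; rewrite xj.
have psi_inj x y : (psi x).1 = (psi y).1 -> (psi x).2 = (psi y).2 :> nat -> x = y.
  move=> e1 e2; have [hx _] := hit_psi x; have [hy _] := hit_psi y.
  have : iter (psi x).2 V x = iter (psi x).2 V y by rewrite hx e2 hy e1.
  by elim: ((psi x).2 : nat) => // c IH /= /perm_inj.
have psiI : injective psi.
  by move=> x y e; apply: psi_inj; rewrite e.
pose fibre a := [set x | (psi x).1 == a].
have fd a : #|fibre a| < d.+1.
  by rewrite ltnS -[X in _ <= X](card_ord d) max_card.
(* Heights are defined as fibre sizes. Stepping back along a tower lowers the level by one, so the
   levels in a fibre form an initial segment, of that length. *)
pose l : {ffun 'I_k -> 'I_d.+1} := [ffun a => Ordinal (fd a)].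
pose level a := [set (psi x).2 | x in fibre a].
have level_card a : #|level a| = l a.
  rewrite ffunE /= card_in_imset // => x y; rewrite !inE => /eqP xa /eqP ya e.
  by apply: psi_inj; rewrite ?xa ?ya ?e.
have levelE a : level a = [set j : 'I_d | j < l a].
  rewrite -level_card; apply: downward_closed_set => j j' j'j.
  case/imsetP => x; rewrite inE => /eqP xa ej.
  have [c] := ubnP (j - j'); elim: c j x xa j'j ej => // c IH j x xa j'j ej jc.
  have [e|ne] := eqVneq (j : nat) j'.
    by apply/imsetP; exists x; rewrite ?inE ?xa // -ej; apply: val_inj.
  have [j0 jj0] : exists j0, (j : nat) = j0.+1.
    by case: (j : nat) ne j'j => [|j0]; [rewrite leqn0 eq_sym => /negbTE -> | exists j0].
  have [v1 v2] := psiP x j0 (etrans (congr1 val (esym ej)) jj0).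
  apply: (IH (psi (V x)).2 (V x)) => //; rewrite ?v1 // v2.
    by rewrite -ltnS -jj0 ltn_neqAle j'j eq_sym ne.
  by move: jc; rewrite jj0 subSn // -ltnS -jj0 ltn_neqAle j'j eq_sym ne.
have surj a j : j < l a -> exists2 x, (psi x).1 = a & (psi x).2 = j :> nat.
  move=> jl; have jd : j < d by apply: leq_trans jl _; rewrite -ltnS.
  have : Ordinal jd \in level a by rewrite levelE inE.
  by case/imsetP => x; rewrite inE => /eqP xa e; exists x; rewrite // -e.
have ltl x : (psi x).2 < l (psi x).1.
  have : (psi x).2 \in level (psi x).1 by apply/imsetP; exists x; rewrite ?inE.
  by rewrite levelE inE.
have lpos a : 0 < l a.
  by have := ltl (i a); have [-> ->] := psi0 a.
have jump x : ~~ ((psi x).2.+1 < l (psi x).1) -> s x \in codom i.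
  apply: contraNT => /psiS[h1 h2]; by rewrite -h2 -h1.
(* The top of each tower is sent to a marked point; this is the first return map. *)
have /fin_all_exists[g hg] (a : 'I_k) : exists b, exists x,
    [/\ (psi x).1 = a, (psi x).2 = (l a).-1 :> nat & s x = i b].
  have [x x1 x2] : exists2 x, (psi x).1 = a & (psi x).2 = (l a).-1 :> nat.
    by apply: surj; rewrite prednK.
  have /codomP[b e] : s x \in codom i by apply: jump; rewrite x1 x2 prednK // ltnn.
  by exists b, x.
have gI : injective g.
  move=> a a' e; have [x [x1 _ x3]] := hg a; have [x' [x1' _ x3']] := hg a'.
  by rewrite -x1 -x1'; congr (psi _).1; apply: (@perm_inj _ s); rewrite x3 x3' e.
exists psi, l, (perm gI); split.
- apply/and4P; split; last by apply/forallP.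
  + exact/forallP.
  + rewrite -[X in _ == X](card_ord d) -sum1_card.
    rewrite (partition_big (fun x => (psi x).1) predT) //=; apply/eqP.
    by apply: eq_bigr => a _; rewrite ffunE /= -sum1dep_card.
  by apply/injectiveP.
- by apply/forallP => a; have [-> ->] := psi0 a; rewrite !eqxx.
apply/forallP => x; case: ifPn => h.
  have [y y1 y2] := surj _ _ h; have [v1 v2] := psiP _ _ y2.
  have <- : y = s x.
    by rewrite -[y](permKV s); congr (s _); apply: psi_inj; rewrite ?v1 ?v2.
  by rewrite y1 y2 !eqxx.
have [x' [x1 x2 x3]] := hg (psi x).1.
have -> : x = x'.
  apply: psi_inj; rewrite ?x1 // x2; apply/eqP.
  rewrite -eqSS prednK // eqn_leq; move: h; rewrite -leqNgt => ->.
  by rewrite andbT ltl.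
by rewrite x1 x3 permE; have [-> ->] := psi0 (g (psi x).1); rewrite !eqxx.
Qed.

(** [psi] is forced by induction on the level, starting from the marked points; then [l] counts its
    fibres and [sb] is read off at the tops. *)
Lemma chart_unique i s psi l sb psi' l' sb' :
  chart l psi -> based i psi -> suspension psi l sb s ->
  chart l' psi' -> based i psi' -> suspension psi' l' sb' s ->
  (psi, l, sb) = (psi', l', sb').
Proof.
move=> c b h c' b' h'.
have epsi : psi = psi'.
  apply/ffunP => x.
  suff [e1 e2] : (psi x).1 = (psi' x).1 /\ (psi x).2 = (psi' x).2 :> nat.
    case: (psi x) (psi' x) e1 e2 => [a j] [a' j'] /= -> e.
    by congr (_, _); exact: val_inj.
  have [n] := ubnP (psi x).2; elim: n x => // n IH x; rewrite ltnS => xn.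
  case E : (val (psi x).2) => [|j].
    have -> : x = i (psi x).1 by apply: (chart_inj c); rewrite ?(base1 b) ?(base2 b).
    by rewrite (base1 b) (base1 b') (base2 b').
  have [y y1 y2] : exists2 y, (psi y).1 = (psi x).1 & (psi y).2 = j :> nat.
    by apply: (chart_surj c); apply: leq_trans (chart_lt c x); rewrite E.
  have hy : (psi y).2.+1 < l (psi y).1 by rewrite y1 y2 -E; exact: chart_lt.
  have [s1 s2] := step_up h hy.
  have sy : s y = x by apply: (chart_inj c); rewrite ?s1 ?s2 ?y1 ?y2 ?E.
  have [|e1 e2] := IH y; first by rewrite y2 -[_ < _]/(j.+1 <= n) -E.
  case Ey : ((psi' y).2.+1 < l' (psi' y).1).
    by have [u1 u2] := step_up h' Ey; rewrite -sy u1 u2 s1 e1 -e2 y2.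
  have xi : x = i (sb' (psi' y).1) by rewrite -sy (step_jump c' h' b' Ey).
  by move: E; rewrite xi -[val _]/(nat_of_ord _) (base2 b).
subst psi'.
have el : l = l'.
  apply/ffunP => a; apply: val_inj => /=.
  by rewrite -(card_chart_fibre c) -(card_chart_fibre c').
subst l'; congr (_, _); apply/permP => a.
have [x x1 x2] : exists2 x, (psi x).1 = a & (psi x).2 = (l a).-1 :> nat.
  by apply: (chart_surj c); rewrite prednK // (chart_pos c).
have top : ((psi x).2.+1 < l (psi x).1) = false.
  by rewrite x1 x2 prednK ?ltnn // (chart_pos c).
have := step_jump c h b top; rewrite (step_jump c' h' b' top) x1.
by move/(congr1 (fun z => (psi z).1)); rewrite !(base1 b).
Qed.

(** Double counting: marked pairs [(i, s)] correspond one to one to triples [(psi, l, sb)], and each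
    admissible [(l, sb)] has [d] factorial charts. *)
Lemma sum_marked (F : {ffun 'I_k -> 'I_d} * 'S_d -> nat)
    (G : {ffun 'I_k -> 'I_d.+1} * 'S_k -> nat) :
  (forall psi l sb i s, chart l psi -> based i psi -> suspension psi l sb s ->
    F (i, s) = G (l, sb)) ->
  \sum_(u | marked u.1 u.2) F u =
  d`! * \sum_(v : {ffun 'I_k -> 'I_d.+1} * 'S_k |
    [forall a, 0 < v.1 a] && (\sum_a v.1 a == d)) G v.
Proof.
move=> FG.
pose R (u : {ffun 'I_k -> 'I_d} * 'S_d)
    (t : {ffun 'I_d -> 'I_k * 'I_d} * ({ffun 'I_k -> 'I_d.+1} * 'S_k)) :=
  [&& chart t.2.1 t.1, based u.1 t.1 & suspension t.1 t.2.1 t.2.2 u.2].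
rewrite (@sum_correspondence _ _ _ R _ (fun t => chart t.2.1 t.1) _
  (fun t => G t.2)).
- rewrite -(pair_big_dep predT (fun psi v => chart v.1 psi) (fun _ v => G v)) /=.
  rewrite (exchange_big_dep predT) //= [in RHS]big_mkcond big_distrr /=.
  apply: eq_bigr => -[l sb] _ /=; rewrite sum_nat_const.
  case: ifPn => [/andP[/forallP l0 /eqP ls]|nl].
    by congr (_ * _); rewrite -(card_charts l0 ls); apply: eq_card => t; rewrite !inE.
  rewrite muln0 eq_card0 ?mul0n // => t; rewrite inE.
  by apply: contraNF nl => /and4P[-> -> _ _].
- move=> [i s] /= /chart_exists[psi [l [sb [h1 h2 h3]]]].
  by exists (psi, (l, sb)); rewrite // /R /= h1 h2.
- move=> [psi [l sb]] /= c; have [i [s /andP[b h]]] := suspension_exists c sb.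
  by exists (i, s); [exact: (suspension_marked c h b) | rewrite /R /= c b h].
- move=> [i s] [psi [l sb]] [psi' [l' sb']] /and3P[c b h] /and3P[c' b' h'] _ _.
  by have [-> -> ->] := chart_unique c b h c' b' h'.
- move=> [i s] [i' s'] [psi [l sb]] /and3P[c b h] /and3P[_ b' h'] _ _.
  exact: (suspension_unique c b h b' h').
by move=> [i s] [psi [l sb]] _ _ /and3P[c b h]; exact: FG c b h.
Qed.

End MarkedPermutations.

(** * From marked permutations to edge weightings *)

Lemma sum_fibre_sums (k m B : nat) (l : {ffun 'I_k -> 'I_B.+1})
    (c : 'I_k -> 'I_m) (mu : m.-tuple nat) :
  fibre_sums l c mu -> \sum_a l a = sumn mu.
Proof.
move=> /forallP h; rewrite -sum_tnth (partition_big c predT) //=.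
by apply: eq_bigr => j _; exact/eqP.
Qed.

Lemma transposition_product_marked (d b k : nat) (i : {ffun 'I_k -> 'I_d})
    (p : {ffun 'I_b * bool -> 'I_k}) : injective i ->
  let w := transposition_product [ffun x => i (p x)] in
  (forall a, w (i a) = i (transposition_product p a)) /\
  (forall x, x \notin codom i -> w x = x).
Proof.
move=> iI /=; rewrite /transposition_product; split=> [a|x xi].
  elim/big_rec2: _ a => [|j w w' _ IH] a; first by rewrite !perm1.
  by rewrite !permM !ffunE -inj_tperm // IH.
elim/big_rec: _ => [|j w _ IH]; first by rewrite perm1.
by rewrite permM !ffunE tpermD ?IH //; apply: contraNneq xi => <-; exact: codom_f.
Qed.

Section PatternCount.

Variables (m n : nat) (c : {pred m.-tuple nat * n.-tuple nat}).
Hypothesis hc : is_chamber c.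
Variables (mu : m.-tuple nat) (nu : n.-tuple nat).
Hypothesis cmn : (mu, nu) \in c.
Local Notation d := (sumn mu).

(* An unmarked cycle of [s] is also a cycle of [s * w], so that some [mu_i]
   equals some [nu_j], which is a wall as soon as there is another cycle. *)
Lemma unmarked_colourings (k : nat) (i : {ffun 'I_k -> 'I_d}) (s w : 'S_d) :
  (0 < k)%N -> injective i -> (forall x, x \notin codom i -> w x = x) ->
  ~~ marked i s -> #|colourings mu s| * #|colourings nu (s * w)%g| = 0.
Proof.
move=> k0 iI wx; rewrite /marked.
have /injectiveP -> /= := iI; rewrite negb_forall => /existsP[x].
rewrite negb_exists => /forallP nx; apply/eqP; rewrite -leqn0 leqNgt.
apply/negP; rewrite muln_gt0 => /andP[/card_gt0P[c1] + /card_gt0P[c2]].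
rewrite !inE => /andP[/coloursP h1 /forallP s1] /andP[/coloursP h2 /forallP s2].
have it t : (iter t (s * w)%g x) = iter t s x.
  elim: t => //= t ->; rewrite permM wx //; apply/negP => /codomP[a e].
  have := nx a; rewrite -e -[s (iter t s x)]/(iter t.+1 s x) -permX.
  by rewrite mem_porbit.
have eP : porbit (s * w)%g x = porbit s x.
  apply/setP => y; apply/porbitP/porbitP => -[t ->]; exists t;
  by rewrite !permX it.
have e1 : tnth mu (c1 x) = #|porbit s x|.
  rewrite -(eqP (s1 (c1 x))); apply: eq_card => y.
  by rewrite inE eq_sym h1.
have e2 : tnth nu (c2 x) = #|porbit s x|.
  rewrite -(eqP (s2 (c2 x))) -eP; apply: eq_card => y.
  by rewrite inE eq_sym h2.
have [_ _ _ W] := in_chamber hc cmn.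
have := W ([set c1 x], [set c2 x]).
rewrite !big_set1 e1 e2 eqxx => H.
(* The pair of singletons satisfies a wall equation, so it must be one of the two excluded pairs. It
   is not empty, and not full either, since a marked point lies on another cycle. *)
have nw : ~~ wall_index ([set c1 x], [set c2 x]) by apply/negP => /H.
move: nw; rewrite /wall_index negb_and !negbK => /orP[] /eqP[].
  by move=> /setP/(_ (c1 x)); rewrite !inE eqxx.
move=> /setP/(_ (c1 (i (Ordinal k0)))); rewrite !inE => /eqP e _.
by have := nx (Ordinal k0); rewrite -h1 e eqxx.
Qed.

(** A first return permutation with cycle colourings for [sigma_1] and [sigma_2], independent of the
    values of [mu] and [nu]. Each marked point becomes an edge joining its two colours. *)
Definition skeletons (b k : nat) (p : {ffun 'I_b * bool -> 'I_k})
    (t : 'S_k * {ffun 'I_k -> 'I_m} * {ffun 'I_k -> 'I_n}) :=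
  colours t.1.1 t.1.2 && colours (t.1.1 * transposition_product p)%g t.2.

(** Unmarked permutations contribute 0; the others are traded for return maps and return times, with
    weight [d] factorial, and the return times become edge weights. *)
Lemma sum_injective (b k : nat) (p : {ffun 'I_b * bool -> 'I_k}) : (0 < k)%N ->
  \sum_(i : {ffun 'I_k -> 'I_d} | injectiveb i)
     pair_count mu nu (transposition_product [ffun x => i (p x)])
  = d`! * \sum_(t | skeletons p t) #|edge_weightings t.1.2 t.2 mu nu|.
Proof.
move=> k0; rewrite /pair_count pair_big /=.
pose w (i : {ffun 'I_k -> 'I_d}) := transposition_product [ffun x => i (p x)].
rewrite (bigID (fun u => marked u.1 u.2)) /= [X in _ + X]big1 ?addn0; last first.
  move=> [i s] /= /andP[/andP[/injectiveP iI _] nm].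
  by apply: (unmarked_colourings k0 iI) => //; exact: (transposition_product_marked p iI).2.
pose G (v : {ffun 'I_k -> 'I_d.+1} * 'S_k) :=
  #|small_colourings v.1 v.2 mu| *
  #|small_colourings v.1 (v.2 * transposition_product p)%g nu|.
transitivity (\sum_(u : {ffun 'I_k -> 'I_d} * 'S_d | marked u.1 u.2)
    #|colourings mu u.2| * #|colourings nu (u.2 * w u.1)%g|).
  by apply: eq_bigl => -[i s] /=; rewrite andbT /marked andbA andbb.
rewrite (@sum_marked d k _ G) => [|psi l sb i s ch ba su]; last first.
  rewrite /G /= (card_colourings_suspension ch su ba).
  have iI : injective i.
    by move=> a a' e; rewrite -(base1 ba a) e (base1 ba).
  have [w1 w2] := transposition_product_marked p iI.
  by rewrite (card_colourings_suspension ch (suspension_mul ch su ba w1 w2) ba).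
congr (_ * _); rewrite /G.
(* The product of cardinals is expanded into indicators so that the sum over [l] can be moved
   innermost. *)
transitivity (\sum_(v : {ffun 'I_k -> 'I_d.+1} * 'S_k)
   \sum_(c1 : {ffun 'I_k -> 'I_m}) \sum_(c2 : {ffun 'I_k -> 'I_n})
     (skeletons p (v.2, c1, c2) && (v.1 \in edge_weightings c1 c2 mu nu) : nat)).
  rewrite big_mkcond; apply: eq_bigr => -[l sb] _ /=.
  case: ifPn => [/andP[l0 _]|nl].
    rewrite -!sum1_card big_distrl /= big_mkcond; apply: eq_bigr => c1 _.
    rewrite inE; case: ifPn => [/andP[h1 h2]|nc]; last first.
      rewrite big1 // => c2 _; rewrite /skeletons !inE /=.
      by move: nc; case: (colours _ _); case: (fibre_sums _ _ _) => //=; rewrite ?andbF.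
    rewrite mul1n big_mkcond; apply: eq_bigr => c2 _.
    by rewrite /skeletons !inE /= h1 h2 l0 /=; case: ifP.
  (* An edge weighting is positive with sum [d], so the other [l] contribute nothing. *)
  symmetry; rewrite big1 // => c1 _; rewrite big1 // => c2 _.
  apply/eqP; rewrite eqb0; apply: contra nl => /andP[_]; rewrite inE.
  by case/and3P=> -> /sum_fibre_sums -> _; rewrite eqxx.
rewrite -(pair_big predT predT (fun l sb => \sum_(c1 : {ffun 'I_k -> 'I_m})
  \sum_(c2 : {ffun 'I_k -> 'I_n})
  (skeletons p (sb, c1, c2) && (l \in edge_weightings c1 c2 mu nu) : nat))) /=.
under eq_bigr => l _ do rewrite pair_big pair_big /=.
rewrite exchange_big [RHS]big_mkcond /=; apply: eq_big => [//|[[sb c1] c2] _ /=].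
case: ifP => h; last by rewrite big1 // => l _.
by rewrite -sum1_card [RHS]big_mkcond; apply: eq_bigr => l _ /=; case: ifP.
Qed.

End PatternCount.

(** * Piecewise polynomiality *)

(** This is what the argument asks of [leq] and [ltn], so that both kinds of monotonicity are
    treated at once. *)
Definition order_invariant (e : rel nat) :=
  forall (d k : nat) (t : k.-tuple 'I_d), increasing t ->
    forall i j : 'I_k, e (tnth t i) (tnth t j) = e i j.

Lemma leq_order_invariant : order_invariant leq.
Proof. by move=> d k t /increasing_mono. Qed.

Lemma ltn_order_invariant : order_invariant ltn.
Proof. by move=> d k t /increasing_mono h i j; rewrite /= !ltnNge h. Qed.

Section Formula.

Variables (e : rel nat) (g m n : nat) (c : {pred m.-tuple nat * n.-tuple nat}).
Hypotheses (he : order_invariant e) (hc : is_chamber c).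
Local Notation b := (2 * g + m + n - 2).
Hypothesis b_gt0 : 0 < b.

Definition patterns (k : nat) :=
  [set p : {ffun 'I_b * bool -> 'I_k} | surjective_ffun p && monotone_entries e p].

(** The factor [d] factorial of [sum_injective] cancels the normalisation, and [sum_increasing]
    leaves the reciprocal of [k] factorial. The index sets do not depend on [mu] and [nu]. *)
Lemma hurwitz_formula mu nu : (mu, nu) \in c ->
  (hurwitz e g mu nu = \sum_(k < (2 * b).+1) \sum_(p in patterns k)
    \sum_(t | skeletons p t)
       k`!%:R^-1 * #|edge_weightings t.1.2 t.2 mu nu|%:R)%R.
Proof.
move=> cmn; have [mu0 nu0 _ _] := in_chamber hc cmn.
have d0 : ((sumn mu)`!%:R != 0 :> rat)%R by rewrite pnatr_eq0 -lt0n fact_gt0.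
rewrite /hurwitz card_factorisations //; apply: (mulIf d0); rewrite divfK //.
rewrite big_mkcond sum_patterns card_prod card_ord card_bool mulnC.
rewrite natr_sum mulr_suml; apply: eq_bigr => k _.
rewrite natr_sum mulr_suml [RHS](eq_bigl
  (fun p => surjective_ffun p && monotone_entries e p)) => [|p]; last by rewrite inE.
rewrite [RHS]big_mkcondr; apply: eq_bigr => p _.
rewrite (eq_bigr (fun t => if monotone_entries e p then
  pair_count mu nu (transposition_product (relabel t p)) else 0)); last first.
  by move=> t st; rewrite (monotone_relabel p (he st) st).
case: ifP => _; last by rewrite big1.
(* As [b] is positive, [p] takes a value in ['I_k], so there is a marked point. *)
have k0 : 0 < k by apply: leq_ltn_trans (ltn_ord (p (Ordinal b_gt0, true))).
have kf : (k`!%:R != 0 :> rat)%R by rewrite pnatr_eq0 -lt0n fact_gt0.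
apply: (mulIf kf); rewrite -natrM sum_increasing (sum_injective hc cmn) //.
by rewrite natrM natr_sum -mulr_sumr; field.
Qed.

End Formula.

Definition piecewise_poly (m n : nat) (c : {pred m.-tuple nat * n.-tuple nat})
    (D : nat) (F : m.-tuple nat -> n.-tuple nat -> rat) :=
  exists2 P : {mpoly rat[m + n]}, msize P <= D &
    forall mu nu, (mu, nu) \in c -> F mu nu = eval_at P mu nu.

Lemma piecewise_poly_sum (m n : nat) (c : {pred m.-tuple nat * n.-tuple nat})
    (D : nat) (I : finType) (Q : pred I)
    (F : I -> m.-tuple nat -> n.-tuple nat -> rat) :
  (forall i, Q i -> piecewise_poly c D (F i)) ->
  piecewise_poly c D (fun mu nu => \sum_(i | Q i) F i mu nu)%R.
Proof.
move=> h; have /fin_all_exists[P hP] (i : I) : exists P : {mpoly rat[m + n]},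
    Q i -> msize P <= D /\
      forall mu nu, (mu, nu) \in c -> F i mu nu = eval_at P mu nu.
  by have [/h[P sP eP]|] := boolP (Q i); [exists P | exists 0%R].
exists (\sum_(i | Q i) P i)%R.
  by apply: leq_msize_sum => i Qi; have [] := hP i Qi.
move=> mu nu cmn; rewrite /eval_at raddf_sum /=; apply: eq_bigr => i Qi.
by have [_ ->] := hP i Qi.
Qed.

Lemma hurwitz_piecewise_poly (e : rel nat) (g m n : nat)
    (c : {pred m.-tuple nat * n.-tuple nat}) :
  order_invariant e -> is_chamber c -> 0 < m -> 0 < 2 * g + m + n - 2 ->
  piecewise_poly c (4 * g + m + n - 3).+1 (hurwitz e g (m := m) (n := n)).
Proof.
move=> he hc m0 b0.
pose F (mu : m.-tuple nat) (nu : n.-tuple nat) : rat := (\sum_(k < (2 * (2 * g + m + n - 2)).+1)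
  \sum_(p in patterns e g m n k) \sum_(t | skeletons p t)
  k`!%:R^-1 * #|edge_weightings t.1.2 t.2 mu nu|%:R)%R.
suff [P sP eP] : piecewise_poly c (4 * g + m + n - 3).+1 F.
  by exists P => // mu nu cmn; rewrite -eP // (hurwitz_formula he hc b0 cmn).
apply: piecewise_poly_sum => k _; apply: piecewise_poly_sum => p _.
apply: piecewise_poly_sum => -[[sb c1] c2] _ /=.
have [P sP eP] := edge_weightings_poly c1 c2 m0 hc.
exists (k`!%:R^-1 *: P)%R.
  apply: leq_trans (msizeZ_le _ _) _; apply: leq_trans sP _.
  (* For [k] at most [2 * b], the size bound [k + 2 - (m + n)] is at most [4 * g + m + n - 2]. *)
  by have := ltn_ord k; lia.
by move=> mu nu cmn; rewrite eP // /eval_at mevalZ.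
Qed.

(* Adding a multiple of [sum mu - sum nu] does not change the values. *)
Lemma piecewise_poly_exact (m n D : nat)
    (c : {pred m.-tuple nat * n.-tuple nat})
    (F : m.-tuple nat -> n.-tuple nat -> rat) :
  0 < m -> is_chamber c -> piecewise_poly c D.+2 F ->
  exists P, has_degree D.+1 P /\
    forall mu nu, (mu, nu) \in c -> F mu nu = eval_at P mu nu.
Proof.
move=> m0 hc [P sP eP].
have [sPD|sPD] := eqVneq (msize P) D.+2; first by exists P.
pose v0 := lshift n (Ordinal m0).
pose S : {mpoly rat[m + n]} :=
  (\sum_(i < m) 'X_(lshift n i) - \sum_(j < n) 'X_(rshift m j))%R.
have Sv v : (S.@[v] = \sum_(i < m) v (lshift n i) - \sum_(j < n) v (rshift m j))%R.
  rewrite mevalB; congr (_ - _)%R; rewrite raddf_sum /=; apply: eq_bigr => i _;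
  exact: mevalXU.
have sS : msize S = 2.
  apply/eqP; rewrite eqn_leq; apply/andP; split.
    apply: leq_msizeD; rewrite ?msizeN; apply: leq_msize_sum => i _;
    by rewrite msizeX mdeg1.
  (* [S] is not constant: it is 1 at the unit vector of [v0] and 0 at the origin. *)
  rewrite ltnNge; apply/negP => /msize1_polyC eS.
  have SE v : (S.@[v] = S@_0)%R by rewrite eS mevalC mcoeffC eqxx mulr1.
  have := SE (fun v => (v == v0)%:R)%R; rewrite -(SE (fun _ => 0))%R.
  rewrite !Sv [X in (_ - _ = X - _)%R]big1 // [X in (_ - _ = _ - X)%R]big1 //.
  rewrite (bigD1 (Ordinal m0)) // eqxx big1 => [|i ne]; last first.
    by rewrite (inj_eq (@lshift_inj _ _)) (negbTE ne).
  rewrite big1 => [|j _]; last by rewrite eq_rlshift.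
  by rewrite addr0 !subr0 => /eqP; rewrite oner_eq0.
have S0 : (S != 0)%R by rewrite -msize_poly_eq0 sS.
have X0 : ('X_[U_(v0) *+ D] != 0 :> {mpoly rat[m + n]})%R.
  by rewrite -msize_poly_eq0 msizeX.
(* The monomial brings the correction to degree exactly [D.+1], above that of [P], so its leading
   part survives. *)
pose Q : {mpoly rat[m + n]} := (S * 'X_[U_(v0) *+ D])%R.
have sQ : msize Q = D.+2.
  by rewrite msizeM // sS msizeX mdegMn mdeg1 mul1n.
exists (P + Q)%R; split.
  apply/eqP; rewrite eqn_leq leq_msizeD ?sQ //=.
  rewrite ltnNge; apply/negP => h.
  have : msize Q <= D.+1.
    have -> : Q = ((P + Q) - P)%R by rewrite addrC addKr.
    apply: leq_msizeD => //; rewrite msizeN.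
    by rewrite -ltnS ltn_neqAle sPD.
  by rewrite sQ ltnn.
move=> mu nu cmn; rewrite eP // /eval_at mevalD mevalM.
have [_ _ emn _] := in_chamber hc cmn.
suff -> : (S.@[fun i => (tnth (cat_tuple mu nu) i)%:R] = 0)%R.
  by rewrite mul0r addr0.
rewrite Sv; apply/eqP; rewrite subr_eq0; apply/eqP.
transitivity ((sumn mu)%:R : rat)%R; [rewrite -sum_tnth | rewrite emn -sum_tnth];
  rewrite natr_sum; apply: eq_bigr => i _.
  by rewrite tnth_lshift.
by rewrite tnth_rshift.
Qed.

(** * Non-vanishing in genus 0 with three parts *)

Lemma colours_id (d : nat) : colours 1%g [ffun x : 'I_d => x].
Proof.
apply/coloursP => x y; rewrite !ffunE; apply/eqP/porbitP => [->|[i ->]].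
  by exists 0; rewrite perm1.
by rewrite expg1n perm1.
Qed.

Lemma colours_tperm (c : {ffun 'I_2 -> 'I_1}) (x0 x1 : 'I_2) : x0 != x1 ->
  colours (tperm x0 x1) c.
Proof.
have I2 (x y z : 'I_2) : x != z -> y != z -> x = y.
  by move: x y z => [[|[|//]] ?] [[|[|//]] ?] [[|[|//]] ?] // _ _; exact: val_inj.
move=> ne; apply/coloursP => x y; rewrite !ord1 eqxx; apply/esym.
have [->|nxy] := eqVneq y x; first exact: porbit_id.
suff <- : (tperm x0 x1 ^+ 1)%g x = y by exact: mem_porbit.
rewrite expg1; apply: (I2 _ _ x) => //.
case: tpermP => [->|->|]; rewrite ?(eq_sym x1) //.
by move=> /eqP h0 /eqP h1; case/eqP: ne; apply: (I2 _ _ x); rewrite eq_sym.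
Qed.

Definition single_pattern (b : nat) : {ffun 'I_b * bool -> 'I_2} :=
  [ffun x => if x.2 then ord_max else ord0].

Lemma single_patternP (e : rel nat) (b : nat) : b = 1 ->
  [/\ surjective_ffun (single_pattern b), monotone_entries e (single_pattern b)
    & transposition_product (single_pattern b) = tperm ord_max ord0].
Proof.
move=> ->; split.
- apply/forallP => -[[|[|//]] h]; apply/existsP.
    by exists (ord0, false); rewrite ffunE.
  by exists (ord0, true); rewrite ffunE.
- apply/andP; split; first by apply/forallP => i; rewrite !ffunE.
  by rewrite enum_ordSl; case: (enum _) (size_enum_ord 0).
by rewrite /transposition_product big_ord1 !ffunE.
Qed.

Section ThreeParts.

Variables (e : rel nat) (m n : nat) (c : {pred m.-tuple nat * n.-tuple nat}).
Hypotheses (he : order_invariant e) (hc : is_chamber c).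
Hypothesis b1 : 2 * 0 + m + n - 2 = 1.

(** All terms of [hurwitz_formula] are nonnegative, so one nonempty set of edge weightings, for the
    pattern of a single transposition, is enough. *)
Lemma hurwitz_neq0 (mu : m.-tuple nat) (nu : n.-tuple nat) (sb : 'S_2)
    (c1 : {ffun 'I_2 -> 'I_m}) (c2 : {ffun 'I_2 -> 'I_n}) :
  (mu, nu) \in c -> colours sb c1 -> colours (sb * tperm ord_max ord0)%g c2 ->
  edge_weightings c1 c2 mu nu != set0 -> hurwitz e 0 mu nu != 0%R.
Proof.
move=> cmn h1 h2 ne.
have b0 : 0 < 2 * 0 + m + n - 2 by rewrite b1.
rewrite (hurwitz_formula he hc b0 cmn).
have [ps pm pt] := single_patternP e b1.
have k2 : 2 < (2 * (2 * 0 + m + n - 2)).+1 by rewrite b1.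
have pos k (t : 'S_k * {ffun 'I_k -> 'I_m} * {ffun 'I_k -> 'I_n}) :
    (0 <= k`!%:R^-1 * #|edge_weightings t.1.2 t.2 mu nu|%:R :> rat)%R.
  by rewrite mulr_ge0 // invr_ge0.
apply/negP => /eqP S0.
have S1 := psumr_eq0P (fun k _ => sumr_ge0 _ (fun p _ => sumr_ge0 _
  (fun t _ => pos (k : 'I_(_.+1)) t))) S0 (i := Ordinal k2) isT.
have pP : single_pattern _ \in patterns e 0 m n (Ordinal k2) by rewrite inE ps.
have S2 := psumr_eq0P (fun p _ => sumr_ge0 _ (fun t _ => pos _ t)) S1 pP.
have tP : skeletons (single_pattern (2 * 0 + m + n - 2)) (sb, c1, c2).
  by rewrite /skeletons /= h1 pt.
have /eqP := psumr_eq0P (fun t _ => pos _ t) S2 tP.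
by rewrite mulf_eq0 invr_eq0 !pnatr_eq0 cards_eq0 (negbTE ne).
Qed.

End ThreeParts.

Lemma sum_const_colour (B : nat) (l : {ffun 'I_2 -> 'I_B.+1}) (t : 1.-tuple nat) :
  \sum_a l a = sumn t -> fibre_sums l [ffun=> ord0 : 'I_1] t.
Proof.
move=> h; apply/forallP => i; rewrite (eq_bigl predT) => [|a]; last first.
  by rewrite ffunE (ord1 i).
by rewrite h -sum_tnth big_ord1 (ord1 i).
Qed.

Lemma sum_id_colour (B : nat) (l : {ffun 'I_2 -> 'I_B.+1}) (t : 2.-tuple nat) :
  (forall a, l a = tnth t a :> nat) -> fibre_sums l [ffun x => x] t.
Proof.
move=> h; apply/forallP => i; rewrite (eq_bigl (pred1 i)) => [|a]; last first.
  by rewrite ffunE.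
by rewrite big_pred1_eq h.
Qed.

Lemma tnth_le_sumn (m : nat) (t : m.-tuple nat) i : tnth t i <= sumn t.
Proof. by rewrite -sum_tnth (bigD1 i) //= leq_addr. Qed.

(** One cycle through both marked points is cut in two by the transposition, with [nu] as return
    times. *)
Lemma hurwitz12_neq0 (e : rel nat) (c : {pred 1.-tuple nat * 2.-tuple nat}) mu nu :
  order_invariant e -> is_chamber c -> (mu, nu) \in c -> hurwitz e 0 mu nu != 0%R.
Proof.
move=> he hc cmn; have [_ nu0 emn _] := in_chamber hc cmn.
apply: (hurwitz_neq0 he hc (erefl 1) cmn (sb := tperm ord_max ord0)
  (c1 := [ffun=> ord0]) (c2 := [ffun x => x])).
- exact: colours_tperm.
- by rewrite tperm2; exact: colours_id.
pose l : {ffun 'I_2 -> 'I_(sumn mu).+1} := [ffun a => inord (tnth nu a)].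
have lE a : l a = tnth nu a :> nat.
  have h : tnth nu a < (sumn mu).+1 by rewrite ltnS emn tnth_le_sumn.
  by rewrite ffunE inordK.
apply/set0Pn; exists l; rewrite inE; apply/and3P; split.
- by apply/forallP => a; rewrite lE.
- apply: sum_const_colour; transitivity (\sum_a tnth nu a).
    by apply: eq_bigr => a _.
  by rewrite sum_tnth.
exact: sum_id_colour.
Qed.

Lemma hurwitz21_neq0 (e : rel nat) (c : {pred 2.-tuple nat * 1.-tuple nat}) mu nu :
  order_invariant e -> is_chamber c -> (mu, nu) \in c -> hurwitz e 0 mu nu != 0%R.
Proof.
move=> he hc cmn; have [mu0 _ emn _] := in_chamber hc cmn.
apply: (hurwitz_neq0 he hc (erefl 1) cmn (sb := 1%g)
  (c1 := [ffun x => x]) (c2 := [ffun=> ord0])).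
- exact: colours_id.
- by rewrite mul1g; exact: colours_tperm.
pose l : {ffun 'I_2 -> 'I_(sumn mu).+1} := [ffun a => inord (tnth mu a)].
have lE a : l a = tnth mu a :> nat.
  by rewrite ffunE inordK // ltnS tnth_le_sumn.
apply/set0Pn; exists l; rewrite inE; apply/and3P; split.
- by apply/forallP => a; rewrite lE.
- exact: sum_id_colour.
apply: sum_const_colour; transitivity (\sum_a tnth mu a).
  by apply: eq_bigr => a _.
by rewrite sum_tnth.
Qed.

(** In positive degree the leading part can be corrected by a multiple of [sum mu - sum nu]. In
    degree 0 this is impossible, and the constant must be shown to be nonzero. *)
Lemma hurwitz_exact_poly (e : rel nat) (g m n : nat)
    (c : {pred m.-tuple nat * n.-tuple nat}) :
  order_invariant e -> is_chamber c -> 0 < m -> 0 < n ->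
  (g, n + m) <> (0, 2) ->
  exists P, has_degree (4 * g + m + n - 3) P /\
    forall mu nu, (mu, nu) \in c -> hurwitz e g mu nu = eval_at P mu nu.
Proof.
move=> he hc m0 n0 gmn.
(* With [m] and [n] positive, [b] is 0 only for the excluded pair. *)
have b0 : 0 < 2 * g + m + n - 2.
  by case: g gmn => [|g'] gmn; [case: m n m0 n0 gmn {c hc} => [|[|m']] [|[|n']] //; lia | lia].
have pp := hurwitz_piecewise_poly he hc m0 b0.
case E : (4 * g + m + n - 3) pp => [|D] pp; last exact: piecewise_poly_exact pp.
have [P sP eP] := pp; exists P; split=> //.
have [[[mu nu] cmn] _] := hc.
apply/eqP; rewrite eqn_leq sP lt0n msize_poly_eq0.
suff : hurwitz e g mu nu != 0%R.
  by rewrite eP // /eval_at; apply: contraNneq => ->; rewrite meval0.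
(* Expected degree 0 together with [b0] leaves genus 0 and three parts in total. *)
have eg : g = 0 by lia.
have emn : (m = 1 /\ n = 2) \/ (m = 2 /\ n = 1) by lia.
move: c hc mu nu cmn {pp sP eP P E b0 gmn}; rewrite eg.
case: emn => -[-> ->] c hc mu nu cmn; first exact: hurwitz12_neq0 hc cmn.
exact: hurwitz21_neq0 hc cmn.
Qed.

Theorem theorem4p1 (g m n : nat) (hm : (0 < m)%N) (hn : (0 < n)%N)
    (hgmn : (g, (n + m)%N) <> (0%N, 2%N))
    (c : {pred m.-tuple nat * n.-tuple nat}) (hc : is_chamber c) :
  exists Ple Plt : {mpoly rat[m + n]},
    [/\ has_degree (4 * g + m + n - 3)%N Ple,
        has_degree (4 * g + m + n - 3)%N Plt
      & forall (mu : m.-tuple nat) (nu : n.-tuple nat), (mu, nu) \in c ->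
          hurwitz_le g mu nu = eval_at Ple mu nu /\
          hurwitz_lt g mu nu = eval_at Plt mu nu].
Proof.
have [Ple [dle ele]] := hurwitz_exact_poly leq_order_invariant hc hm hn hgmn.
have [Plt [dlt elt]] := hurwitz_exact_poly ltn_order_invariant hc hm hn hgmn.
by exists Ple, Plt; split=> // mu nu cmn; split; [exact: ele | exact: elt].
Qed.
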